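(* Let $d\geq 3$ and let $D$ be a face-rooted $d$-angulation. Then $D$ admits a $d/(d-2)$-orientation if and only if $D$ has girth $d$. In this case, the (unique) minimal $d/(d-2)$-orientation of $D$ belongs to $\widetilde{\mathcal B}$.
   Context: A map is a connected finite graph (loops and multiple edges allowed) embedded in the oriented sphere, up to orientation-preserving homeomorphism; faces are the components of the complement, corners are the angular sectors between consecutive half-edges around a vertex, and the degree of a face or vertex is its number of incident corners. A $d$-angulation is a map all of whose faces have degree $d$. The girth of a map is the minimal length of a cycle (infinite for a tree). A face-rooted map has a marked face, the root-face; vertices and edges incident to the root-face are outer, the others inner; the outer degree is the degree of the root-face. A biorientation of a map assigns to each half-edge a direction, ingoing (toward its incident vertex) or outgoing; an edge is $i$-way if exactly $i$ of its two half-edges are ingoing. A directed path through vertices $v_1,\dots,v_{k+1}$ uses, for each $i$, an edge between $v_i$ and $v_{i+1}$ that is either 2-way or 1-way with its ingoing half-edge at $v_{i+1}$; a circuit is a simple closed directed path. A biorientation is accessible from $v$ if every vertex is reachable from $v$ by a directed path. In a face-rooted biorientation, a circuit is clockwise if the root-face is on its left and counterclockwise otherwise; the biorientation is minimal if it has no counterclockwise circuit. A weighted biorientation assigns a real weight to each half-edge; the weight of an edge is the sum of the weights of its two half-edges, and the weight of a vertex is the sum of the weights of its incident ingoing half-edges. An $\mathbb N$-biorientation is a weighted biorientation with weights in $\{0,1,2,\dots\}$ such that ingoing half-edges have positive weight and outgoing half-edges have weight $0$. A face-rooted biorientation is clockwise-minimal if it is minimal and each outer edge is either 2-way or 1-way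 with a non-root face on its right; it is accessible if it is accessible from some outer vertex. It is admissible if (i) the contour of the root-face is a simple cycle, (ii) each outer vertex has indegree $1$, (iii) each outer edge is 1-way with weights $0$ on its outgoing and $1$ on its ingoing half-edge. $\widetilde{\mathcal B}$ denotes the set of face-rooted weighted biorientations that are clockwise-minimal, accessible and admissible. A $d/(d-2)$-orientation of a face-rooted $d$-angulation is an $\mathbb N$-biorientation in which each inner edge has weight $d-2$, each inner vertex has weight $d$, each outer edge has weight $1$, and each outer vertex has weight $1$. If a face-rooted map admits an $\mathbb N$-biorientation with prescribed vertex weights and edge weights, it admits a unique minimal one. *)

(* Defs.v *)
From mathcomp Require Import all_boot.
From mathcomp Require Import fingroup perm.

Set Implicit Arguments.
Unset Strict Implicit.
Unset Printing Implicit Defensive.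

(* A map is encoded by a finite set T of darts (half-edges),
   - alpha : fixed-point-free involution pairing the two half-edges of an edge,
   - sigma : the counterclockwise rotation of half-edges around their vertex.
   Vertices = sigma-orbits, edges = alpha-orbits, faces = phi-orbits where
   phi x = sigma (alpha x).  A dart x lies in the face on the RIGHT of x when x
   is directed away from its vertex; the corner of that face at the vertex of x
   is the angular sector between sigma^-1 x and x.  Hence corners correspond to
   darts, deg(vertex of x) = order sigma x, deg(face of x) = order phi x. *)

Section Maps.
Variables (T : finType) (alpha sigma : {perm T}).

Definition phi (x : T) : T := sigma (alpha x).

Definition same_vertex (x y : T) : bool := fconnect sigma x y.
Definition same_face (x y : T) : bool := fconnect phi x y.

(* connected, spherical (genus 0: Euler V - E + F = 2) combinatorial map *)
Definition is_map : Prop :=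
  [/\ forall x, alpha (alpha x) = x,
      forall x, alpha x != x,
      forall x y, connect (fun u v => (v == alpha u) || (v == sigma u)) x y &
      2 * fcard sigma T + 2 * fcard phi T = #|T| + 4].

Definition is_dangulation (d : nat) : Prop := forall x, fingraph.order phi x = d.

(* A cycle of length k of the underlying graph: the darts c 0, ..., c (k-1),
   where c i goes from vertex v_i to vertex v_(i+1) (indices mod k); the
   vertices are pairwise distinct and the edges pairwise distinct. *)
Definition is_cycle (k : nat) (c : nat -> T) : Prop :=
  [/\ 0 < k,
      forall i, i < k -> same_vertex (alpha (c i)) (c (i.+1 %% k)) &
      forall i j, i < k -> j < k -> i != j ->
        [&& ~~ same_vertex (c i) (c j), c j != c i & c j != alpha (c i)]].

Definition girth_eq (d : nat) : Prop :=
  (exists c, is_cycle d c) /\ (forall k c, is_cycle k c -> d <= k).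

Section Rooted.
Variable r : T.

Definition in_root (x : T) : bool := same_face r x.
Definition outer_vertex (x : T) : bool := [exists y, in_root y && same_vertex y x].
Definition outer_edge (x : T) : bool := in_root x || in_root (alpha x).

Section Orient.
(* A weighted biorientation: ing x = true iff half-edge x is ingoing
   (directed toward its incident vertex); w x is the weight of half-edge x. *)
Variables (ing : T -> bool) (w : T -> nat).

Definition N_biorientation : Prop :=
  forall x, (ing x -> 0 < w x) /\ (~~ ing x -> w x = 0).

Definition edge_weight (x : T) : nat := w x + w (alpha x).
Definition vertex_weight (x : T) : nat :=
  \sum_(y | same_vertex x y && ing y) w y.
Definition indegree (x : T) : nat := #|[pred y | same_vertex x y && ing y]|.

Definition dd2_orientation (d : nat) : Prop :=
  N_biorientation /\
  forall x,
    [/\ outer_edge x -> edge_weight x = 1,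
        ~~ outer_edge x -> edge_weight x = d - 2,
        outer_vertex x -> vertex_weight x = 1 &
        ~~ outer_vertex x -> vertex_weight x = d].

(* A circuit: a cycle all of whose steps are directed forward, i.e. the edge
   from v_i to v_(i+1) is 2-way or 1-way with ingoing half-edge at v_(i+1). *)
Definition is_circuit (k : nat) (c : nat -> T) : Prop :=
  is_cycle k c /\ forall i, i < k -> ing (alpha (c i)).

Definition on_cycle (k : nat) (c : nat -> T) (h : T) : bool :=
  [exists i : 'I_k, (h == c i) || (h == alpha (c i))].

(* Faces in the same region of the complement of the cycle: move inside a face
   (phi) or cross an edge not on the cycle (alpha). *)
Definition region_rel (k : nat) (c : nat -> T) : rel T :=
  fun h h' => (h' == phi h) || ((h' == alpha h) && ~~ on_cycle k c h).

(* The root face lies on the left of the cycle: the face of the corner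
   between c 0 and sigma (c 0) (to the left of the cycle at v_0) is in the
   same region as the root face. *)
Definition root_on_left (k : nat) (c : nat -> T) : bool :=
  connect (region_rel k c) (sigma (c 0)) r.

Definition clockwise (k : nat) (c : nat -> T) : Prop :=
  is_circuit k c /\ root_on_left k c.
Definition counterclockwise (k : nat) (c : nat -> T) : Prop :=
  is_circuit k c /\ ~~ root_on_left k c.

Definition minimal : Prop := forall k c, ~ counterclockwise k c.

Definition clockwise_minimal : Prop :=
  minimal /\
  forall x, outer_edge x ->
    (ing x && ing (alpha x)) \/
    (* 1-way from the vertex of x to the vertex of alpha x; the face on the
       right of this directed edge is the face of x *)
    (~~ ing x && ing (alpha x) && ~~ in_root x) \/
    (ing x && ~~ ing (alpha x) && ~~ in_root (alpha x)).

Definition acc_rel : rel T := fun g h => (h == sigma g) || ((h == alpha g) && ing h).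
Definition accessible : Prop :=
  exists2 g, in_root g & forall h, connect acc_rel g h.

Definition admissible : Prop :=
  [/\ (* (i) the contour of the root face is a simple cycle *)
      forall x y, in_root x -> in_root y -> x != y ->
        ~~ same_vertex x y && (y != alpha x),
      forall x, outer_vertex x -> indegree x = 1 &
      forall x, outer_edge x ->
        [&& ing x != ing (alpha x), w x == ing x & w (alpha x) == ing (alpha x)]].

Definition in_Btilde : Prop := [/\ clockwise_minimal, accessible & admissible].

End Orient.
End Rooted.
End Maps.

(* Main.v *)
Require Import Defs.
From mathcomp Require Import all_boot.
From mathcomp Require Import fingroup perm.
From mathcomp Require Import zify.
From Stdlib Require Import Classical.

(** Keep only the edges of an edge-closed set [A] of darts.  The components of
    [glue sigma A] are those of the remaining graph and the components of
    [glue phi (~: A)] are its regions.  Adding an edge increases (regions -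
    components) by at most 1, so that Euler's formula for the whole map forces
    Euler's formula for every [A].  In particular the two sides of an edge lying
    on a cycle belong to different regions (Jordan).

    Counting in the disc bounded by a cycle of length [k] on the side away from
    the root gives [d V' = (d - 2) E' + d - k] for the interior vertices and
    edges, whereas an orientation satisfies [d V' <= (d - 2) E']: hence
    [d <= k].  Conversely, if the girth is [d] then every region of a subgraph
    without leaves has degree at least [d], and Euler's formula becomes Hall's
    condition for distributing the edge weights to the vertices.  Reversing a
    counterclockwise circuit decreases a potential, so minimal orientations
    exist.  In an orientation the contour of the root face is a directed
    circuit, whose direction is forced by minimality; vertices that cannot be
    reached from it would contradict the strict form of Hall's condition for
    sets of inner vertices. *)

Set Implicit Arguments.
Unset Strict Implicit.
Unset Printing Implicit Defensive.

(** * Components of glued orbits *)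

Section Components.
Variable T : finType.
Implicit Types e : rel T.

Lemma connect_sym_intro e :
  (forall x y, e x y -> connect e y x) -> connect_sym e.
Proof.
move=> He; suff H x y : connect e x y -> connect e y x.
  by move=> x y; apply/idP/idP; apply: H.
case/connectP=> p; elim: p x => [|z p IHp] x /=; first by move=> _ ->.
by case/andP=> /He Hzx /IHp{}IHp /IHp/connect_trans; apply.
Qed.

Lemma connect_step e x y z :
  connect_sym e -> e y z -> connect e x z = connect e x y.
Proof.
move=> Se /connect1 yz; apply/idP/idP => /connect_trans; apply=> //.
by rewrite Se.
Qed.

Lemma connect_ind e (P : T -> Prop) x y :
  connect e x y -> P x -> (forall u v, e u v -> P u -> P v) -> P y.
Proof.
case/connectP=> p; elim: p x => [|z p IHp] x /=; first by move=> _ ->.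
by case/andP=> xz /IHp{}IHp /IHp{}IHp Px H; apply: IHp => //; apply: H xz Px.
Qed.

(** [h] is the length of a shortest path from [x0]; the last step of such a path starts strictly
    closer to [x0]. It later measures the distance from the root dart. *)
Lemma connect_rank e x0 : (forall x, connect e x0 x) ->
  exists h : T -> nat, forall x, x != x0 -> exists2 y, e y x & h y < h x.
Proof.
move=> H; pose P x n := [exists p : n.-tuple T, path e x0 p && (last x0 p == x)].
have Pp x p : path e x0 p -> last x0 p = x -> P x (size p).
  by move=> pp lp; apply/existsP; exists (in_tuple p); rewrite /= pp lp eqxx.
have exP x : exists n, P x n.
  by case/connectP: (H x) => p pp Ex; exists (size p); apply: Pp.
exists (fun x => ex_minn (exP x)) => x xx0; case: ex_minnP => n /existsP[[p /= sp]].
case/andP; case/lastP: p sp => [|p z] sp; first by move=> _ /eqP/= E; rewrite -E eqxx in xx0.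
rewrite rcons_path last_rcons => /andP[pp ez] /eqP zx _; exists (last x0 p); first by rewrite -zx.
case: ex_minnP => m _ /(_ (size p)) Hm.
by rewrite -(eqP sp) size_rcons ltnS; apply: Hm; apply: Pp.
Qed.

Lemma n_comp_sub_eq e e' (a : {pred T}) :
  {in a, forall x, connect e x =1 connect e' x} -> n_comp e a = n_comp e' a.
Proof.
move=> H; apply: eq_card => x; rewrite !inE; apply: andb_id2r => xa.
by rewrite /roots /root (eq_pick (H x xa)).
Qed.

Lemma n_comp_gt0 e (a : {pred T}) x :
  connect_sym e -> closed e a -> x \in a -> 0 < n_comp e a.
Proof.
move=> Se ca xa; apply/card_gt0P; exists (root e x); rewrite !inE roots_root //=.
by rewrite -(closed_connect ca (connect_root e x)).
Qed.

(** The link between [u] and [v] can only merge their two [e]-components. Once the component of [u]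
    is left out, the others stay apart under [e'], so [root e'] is injective on their roots. *)
Lemma n_comp_merge e e' u v :
  connect_sym e -> connect_sym e' ->
  (forall x y, e' x y ->
     connect e x y \/ (x = u /\ y = v) \/ (x = v /\ y = u)) ->
  n_comp e T <= (n_comp e' T).+1.
Proof.
move=> Se Se' H.
have K x y : connect e' x y -> connect e x y \/
    (connect e x u || connect e x v) /\ (connect e y u || connect e y v).
  case/connectP=> p; elim: p x => [|z p IHp] x /=.
    by move=> _ ->; left; rewrite connect0.
  case/andP=> xz /IHp{}IHp /IHp{}IHp.
  case: (H _ _ xz) => [exz|[[-> zv]|[-> zu]]].
  - case: IHp => [ezy|[]]; first by left; exact: connect_trans ezy.
    move=> ez ey; right; split=> //.
    by case/orP: ez => ez; rewrite (connect_trans exz ez) ?orbT.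
  - right; rewrite connect0; split=> //.
    case: IHp; rewrite zv; last by case.
    by rewrite Se => ->; rewrite orbT.
  - right; rewrite connect0 orbT; split=> //.
    case: IHp; rewrite zu; last by case.
    by rewrite Se => ->.
pose X := [predD1 roots e & root e u].
have HX : n_comp e T <= #|X|.+1.
  rewrite /n_comp_mem (cardD1 (root e u)) -add1n leq_add //; first by case: (_ \in _).
  by apply: subset_leq_card; apply/subsetP=> x; rewrite !inE /= => /andP[-> /andP[]].
apply: leq_trans HX _; rewrite ltnS -(card_in_imset (f := root e') (D := X)).
  apply: subset_leq_card; apply/subsetP=> y /imsetP[x _ ->].
  by rewrite !inE roots_root.
move=> x y; rewrite !inE => /andP[xu /eqP rx] /andP[yu /eqP ry] /eqP.
rewrite root_connect // => /K.
have no z : z != root e u -> root e z = z -> connect e z u = false.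
  by move=> zu rz; apply/negP; rewrite -root_connect // rz => /eqP E; rewrite E eqxx in zu.
case=> [|[]]; first by rewrite -root_connect // rx ry => /eqP.
rewrite !no //= => xv yv.
by apply/eqP; rewrite -rx -ry root_connect //; apply: connect_trans xv _; rewrite Se.
Qed.

Lemma n_comp_eq1 e : (forall x y, connect e x y) -> T -> n_comp e T = 1.
Proof.
move=> H x0.
have Se : connect_sym e by move=> x y; rewrite !H.
rewrite -(@n_comp_connect _ e Se x0); apply: eq_n_comp_r => y.
by rewrite !inE H.
Qed.

End Components.

(** * Orbits of a permutation glued along a set of edges *)

Section Glue.
Variables (T : finType) (alpha : {perm T}).

Definition glue (p : T -> T) (B : {set T}) : rel T :=
  fun x y => (y == p x) || ((y == alpha x) && (x \in B)).

Definition edge (x : T) : {set T} := [set x; alpha x].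

Definition edge_closed (A : {set T}) := forall x, (alpha x \in A) = (x \in A).

Hypothesis alphaK : forall x, alpha (alpha x) = x.

Lemma edge_closedC A : edge_closed A -> edge_closed (~: A).
Proof. by move=> HA x; rewrite !inE HA. Qed.

Lemma edge_closedU A B : edge_closed A -> edge_closed B -> edge_closed (A :|: B).
Proof. by move=> HA HB x; rewrite !inE HA HB. Qed.

Lemma edge_closedD A B : edge_closed A -> edge_closed B -> edge_closed (A :\: B).
Proof. by move=> HA HB x; rewrite !inE HA HB. Qed.

Lemma edge_closed_edge x : edge_closed (edge x).
Proof.
move=> y; rewrite !inE (inj_eq perm_inj) orbC.
by congr (_ || _); apply/eqP/eqP=> [<-|->]; rewrite alphaK.
Qed.

Lemma edge_closed0 : edge_closed set0. Proof. by move=> x; rewrite !inE. Qed.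

Lemma glue_orbit p B : subrel (connect (frel p)) (connect (glue p B)).
Proof. by apply: connect_sub => x y /eqP <-; apply: connect1; rewrite /glue eqxx. Qed.

Lemma glue_sym p B : injective p -> edge_closed B -> connect_sym (glue p B).
Proof.
move=> Ip HB; apply: connect_sym_intro => x y /orP[/eqP->|/andP[/eqP-> xB]].
  by apply: glue_orbit; rewrite fconnect_sym // fconnect1.
by apply: connect1; rewrite /glue alphaK eqxx HB xB orbT.
Qed.

Lemma glue_mono p (B B' : {set T}) :
  B \subset B' -> subrel (connect (glue p B)) (connect (glue p B')).
Proof.
move=> sBB; apply: connect_sub => x y xy; apply: connect1; move: xy.
by rewrite /glue => /orP[->|/andP[-> /(subsetP sBB)->]]; rewrite ?orbT.
Qed.

Definition ncomp p B := n_comp (glue p B) T.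

Lemma ncomp_add p B x : injective p -> edge_closed B ->
  ncomp p B <= (ncomp p (B :|: edge x)).+1.
Proof.
move=> Ip HB; apply: (@n_comp_merge _ _ _ x (alpha x)).
- exact: glue_sym.
- by apply: glue_sym => //; apply: edge_closedU => //; apply: edge_closed_edge.
move=> y z /orP[yz|]; first by left; apply: connect1; rewrite /glue yz.
rewrite !inE => /andP[/eqP-> /or3P[yB|/eqP->|/eqP->]].
- by left; apply: connect1; rewrite /glue eqxx yB orbT.
- by right; left.
- by right; right; rewrite alphaK.
Qed.

Lemma glue_add_connected p B x : injective p -> edge_closed B ->
  connect (glue p B) x (alpha x) ->
  connect (glue p (B :|: edge x)) =2 connect (glue p B).
Proof.
move=> Ip HB cx y z; apply/idP/idP; last first.
  by apply: glue_mono; rewrite subsetUl.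
apply: connect_sub y z => y z /orP[yz|]; first by apply: connect1; rewrite /glue yz.
rewrite !inE => /andP[/eqP-> /or3P[yB|/eqP->|/eqP->]] //.
- by apply: connect1; rewrite /glue eqxx yB orbT.
- by rewrite alphaK glue_sym.
Qed.

Lemma ncomp_add_connected p B x : injective p -> edge_closed B ->
  connect (glue p B) x (alpha x) -> ncomp p (B :|: edge x) = ncomp p B.
Proof. by move=> Ip HB cx; apply: eq_n_comp; apply: glue_add_connected. Qed.

End Glue.

(** * Euler's formula for submaps *)

Section SphereMap.
Variables (T : finType) (alpha sigma : {perm T}).
Hypothesis alphaK : forall x, alpha (alpha x) = x.
Hypothesis alpha_neq : forall x, alpha x != x.

Local Notation ph := (phi alpha sigma).
Local Notation edge_closed := (edge_closed alpha).
Local Notation edge := (edge alpha).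

Lemma phi_inj : injective ph.
Proof. by move=> x y /perm_inj/perm_inj. Qed.

Lemma phi_alpha x : ph (alpha x) = sigma x.
Proof. by rewrite /phi alphaK. Qed.

Lemma alpha_inj : injective alpha. Proof. exact: perm_inj. Qed.

Lemma sum_alpha (B : {set T}) (m : T -> nat) : edge_closed B ->
  \sum_(y in B) m (alpha y) = \sum_(y in B) m y.
Proof.
by move=> HB; rewrite [RHS](reindex_inj alpha_inj); apply: eq_bigl => y; rewrite HB.
Qed.

(* The face on the right of [sigma y] is the one on the left of [y], so that
   both sums over all of [K] agree; off [B] the two sides of [y] agree. *)
Lemma sum_turn (K B : {set T}) (m : T -> nat) :
  (forall y, (sigma y \in K) = (y \in K)) -> (forall y, m (ph y) = m y) ->
  (forall y, y \notin B -> m (alpha y) = m y) ->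
  \sum_(y in K :&: B) m (alpha y) = \sum_(y in K :&: B) m y.
Proof.
move=> HK Hm HB; have E : \sum_(y in K) m (alpha y) = \sum_(y in K) m y.
  rewrite [RHS](reindex_inj (@perm_inj _ sigma)).
  by apply: eq_big => y; rewrite ?HK // => _; rewrite -phi_alpha Hm.
move: E; rewrite (big_setID B) [RHS](big_setID B) /= => /eqP.
rewrite (eq_bigr m (P := fun y => y \in K :\: B)) ?eqn_add2r => [/eqP//|y].
by rewrite inE => /andP[/HB].
Qed.

(** An edge joining two components of [A] is a bridge, so both its sides belong to one region. Apply
    [sum_turn] to the component [K] of [x] and the indicator [m] of the region of [x]: edges of [A]
    in [K] contribute both their darts and cancel, and only [x] without [alpha x] is left. *)
Lemma dual_connect (A : {set T}) x : edge_closed A -> x \notin A ->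
  ~~ connect (glue alpha sigma A) x (alpha x) ->
  connect (glue alpha ph (~: (A :|: edge x))) x (alpha x).
Proof.
move=> HA xA nx; have HA' := edge_closedU HA (edge_closed_edge alphaK x).
have HA'C := edge_closedC HA'.
set A' := A :|: edge x in HA' HA'C *.
pose K := [set y | connect (glue alpha sigma A) x y].
pose m y := nat_of_bool (connect (glue alpha ph (~: A')) x y).
have KE y z : glue alpha sigma A y z -> (z \in K) = (y \in K).
  by rewrite !inE; apply/connect_step/glue_sym => //; exact: perm_inj.
have mE y z : glue alpha ph (~: A') y z -> m z = m y.
  move=> yz; congr (nat_of_bool _); apply: connect_step yz.
  by apply: glue_sym => //; exact: phi_inj.
have mph y : m (ph y) = m y by apply: mE; rewrite /glue eqxx.
have := @sum_turn K A' m _ mph _.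
have -> : K :&: A' = x |: (K :&: A).
  apply/setP=> y; rewrite !inE; case: (altP (y =P x)) => [->|_]; first by rewrite connect0 orbT.
  by case: (altP (y =P _)) => [->|_]; rewrite ?(negPf nx) ?orbF.
rewrite !big_setU1 ?inE ?(negPf xA) ?andbF //= (sum_alpha m (B := K :&: A)); last first.
  move=> y; rewrite !inE HA; case yA: (y \in A); rewrite ?andbT ?andbF //.
  by have := KE y (alpha y); rewrite !inE; apply; rewrite /glue eqxx yA orbT.
move=> H; suff : m (alpha x) = m x by rewrite /m connect0; case: connect.
apply/eqP; rewrite -(eqn_add2r (\sum_(y in K :&: A) m y)); apply/eqP; apply: H => y.
  by apply: KE; rewrite /glue eqxx.
by move=> yA; apply: mE; rewrite /glue eqxx inE yA orbT.
Qed.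

(** If the ends of [x] are already joined in [A], the components stay the same and at most one
    region is gained. Otherwise [x] is a bridge: the regions stay the same and at most one component
    is lost. *)
Lemma ncomp_step (A : {set T}) x : edge_closed A -> x \notin A ->
  ncomp alpha ph (~: A) + ncomp alpha sigma (A :|: edge x) + 1 >=
  ncomp alpha ph (~: (A :|: edge x)) + ncomp alpha sigma A.
Proof.
move=> HA xA; have Is : injective sigma by exact: perm_inj.
have HC : edge_closed (~: (A :|: edge x)).
  by apply/edge_closedC/edge_closedU => //; apply: edge_closed_edge.
have EC : ~: A = ~: (A :|: edge x) :|: edge x.
  apply/setP=> y; rewrite !inE negb_or; case: (altP (y =P x)) => [->|_].
    by rewrite (negPf xA) orbT.
  by case: (altP (y =P _)) => [->|_]; rewrite ?HA ?xA ?orbT ?andbT ?orbF.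
have [c|nc] := boolP (connect (glue alpha sigma A) x (alpha x)).
  have := ncomp_add alphaK x phi_inj HC; rewrite -EC.
  by rewrite (ncomp_add_connected alphaK Is HA c); lia.
have := ncomp_add_connected alphaK phi_inj HC (dual_connect HA xA nc).
rewrite -EC => ->; have := ncomp_add alphaK x Is HA; lia.
Qed.

(** Twice (regions - components) minus the number of darts never increases when edges are added one
    at a time; each edge has two darts, hence the factor 2. *)
Lemma ncomp_chain (A B : {set T}) : edge_closed A -> edge_closed B -> A \subset B ->
  2 * ncomp alpha ph (~: B) + 2 * ncomp alpha sigma A + #|A| <=
  2 * ncomp alpha ph (~: A) + 2 * ncomp alpha sigma B + #|B|.
Proof.
have [n] := ubnP #|B :\: A|; elim: n A => // n IHn A ltn HA HB sAB.
have [|/set0Pn[x]] := boolP (B :\: A == set0).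
  by rewrite setD_eq0 => sBA; have -> : A = B by apply/eqP; rewrite eqEsubset sAB.
rewrite inE => /andP[xA xB]; have HA' := edge_closedU HA (edge_closed_edge alphaK x).
have cA' : #|A :|: edge x| = #|A| + 2.
  rewrite cardsU (_ : A :&: edge x = set0) ?cards0 ?subn0 ?cards2 1?eq_sym ?alpha_neq //.
  apply/setP=> y; rewrite !inE; case: (altP (y =P x)) => [->|_]; first by rewrite (negPf xA).
  by case: (altP (y =P _)) => [->|_]; rewrite ?HA ?(negPf xA) ?andbF.
have sA'B : A :|: edge x \subset B.
  by rewrite subUset sAB; apply/subsetP=> y; rewrite !inE => /orP[]/eqP->; rewrite ?HB.
have := IHn (A :|: edge x) _ HA' HB sA'B; have := ncomp_step HA xA; rewrite cA'.
suff : #|B :\: (A :|: edge x)| < n by move=> -> + /(_ isT); lia.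
rewrite -ltnS; apply: leq_trans ltn; rewrite ltnS; apply: proper_card.
rewrite properE setDS ?subsetUl //=; apply/subsetPn; exists x; by rewrite !inE ?xA ?xB ?eqxx ?orbT.
Qed.

Hypothesis connected :
  forall x y, connect (fun u v => (v == alpha u) || (v == sigma u)) x y.
Hypothesis euler : 2 * fcard sigma T + 2 * fcard ph T = #|T| + 4.

Lemma ncomp_set0 p : ncomp alpha p set0 = fcard p T.
Proof.
apply: eq_n_comp => x y; apply: eq_connect => u v.
by rewrite /glue inE andbF orbF eq_sym.
Qed.

Lemma connect_glue_sigmaT x y : connect (glue alpha sigma setT) x y.
Proof.
apply: connect_sub (connected x y) => u v uv; apply: connect1.
by rewrite /glue inE andbT orbC.
Qed.

Lemma connect_glue_phiT x y : connect (glue alpha ph setT) x y.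
Proof.
have HT : edge_closed setT by move=> z; rewrite !inE.
apply: connect_sub (connected x y) => u v /orP[]/eqP->.
  by apply: connect1; rewrite /glue inE eqxx orbT.
apply: (@connect_trans _ _ (alpha u)); apply: connect1.
  by rewrite /glue inE eqxx orbT.
by rewrite /glue phi_alpha eqxx.
Qed.

(** By Euler's formula for the whole map, the monotone quantity of [ncomp_chain] has the same value
    at [set0] and at [setT]; it is therefore constant in between. *)
Lemma ncomp_euler (A : {set T}) : T -> edge_closed A ->
  2 * ncomp alpha ph (~: A) + 2 * fcard sigma T = 2 + 2 * ncomp alpha sigma A + #|A|.
Proof.
move=> x0 HA; have H0 := edge_closed0 alpha.
have HT : edge_closed setT by move=> z; rewrite !inE.
have := ncomp_chain H0 HA (sub0set A); have := ncomp_chain HA HT (subsetT A).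
rewrite setC0 setCT !ncomp_set0 cards0 cardsT.
rewrite /ncomp (n_comp_eq1 connect_glue_sigmaT x0) (n_comp_eq1 connect_glue_phiT x0).
by move: euler; lia.
Qed.

(** Removing [x] keeps the components of [A]. If both sides of [x] were in one region the regions
    would be kept too, but [ncomp_euler] forces a change because two darts disappear. *)
Lemma cut_edge (A : {set T}) x : edge_closed A -> x \in A ->
  connect (glue alpha sigma (A :\: edge x)) x (alpha x) ->
  ~~ connect (glue alpha ph (~: A)) x (alpha x).
Proof.
move=> HA xA c; apply/negP => nc; have He := edge_closed_edge alphaK x.
have HD := edge_closedD HA He; have HC := edge_closedC HA.
have sE : edge x \subset A by apply/subsetP=> y; rewrite !inE => /orP[]/eqP->; rewrite ?HA.
have AE : A :\: edge x :|: edge x = A by rewrite setUC -{2}(setID A (edge x)) (setIidPr sE).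
have := ncomp_add_connected alphaK (@perm_inj _ sigma) HD c; rewrite AE => gE.
have := ncomp_add_connected alphaK phi_inj HC nc.
have -> : ~: A :|: edge x = ~: (A :\: edge x) by rewrite setCD.
have := ncomp_euler x HD; have := ncomp_euler x HA.
have : #|A| = #|A :\: edge x| + 2.
  by rewrite -(cardsID (edge x) A) (setIidPr sE) cards2 eq_sym alpha_neq addnC.
by lia.
Qed.

End SphereMap.

(** * The two sides of a cycle *)

Section Jordan.
Variables (T : finType) (alpha sigma : {perm T}).
Hypothesis Hmap : is_map alpha sigma.

Local Notation ph := (phi alpha sigma).
Local Notation edge_closed := (edge_closed alpha).
Local Notation edge := (edge alpha).

Let alphaK : forall x, alpha (alpha x) = x. Proof. by case: Hmap. Qed.
Let alpha_neq : forall x, alpha x != x. Proof. by case: Hmap. Qed.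
Let phI : injective ph := @phi_inj T alpha sigma.

Variables (k : nat) (c : nat -> T).
Hypothesis Hc : is_cycle alpha sigma k c.

Definition cycle_darts : {set T} := [set x | on_cycle alpha k c x].
Local Notation C := cycle_darts.

Lemma cycle_dartsP x :
  reflect (exists2 i, i < k & x = c i \/ x = alpha (c i)) (x \in C).
Proof.
rewrite inE; apply: (iffP existsP) => [[i Hi]|[i ik Hi]].
  by exists i => //; case/orP: Hi => /eqP; [left|right].
by exists (Ordinal ik); case: Hi => /= /eqP ->; rewrite ?orbT.
Qed.

Lemma cycle_darts_closed : edge_closed C.
Proof.
suff H x : x \in C -> alpha x \in C.
  by move=> x; apply/idP/idP => [/H|/H//]; rewrite alphaK.
case/cycle_dartsP=> i ik Hi; apply/cycle_dartsP; exists i => //.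
by case: Hi => ->; [right|left; rewrite alphaK].
Qed.

Lemma region_relE : region_rel alpha sigma k c =2 glue alpha ph (~: C).
Proof. by move=> x y; rewrite /region_rel /glue !inE. Qed.

Lemma cycle_mem i : i < k -> (c i \in C) * (alpha (c i) \in C).
Proof.
by move=> ik; rewrite cycle_darts_closed; split; apply/cycle_dartsP; exists i; auto.
Qed.

Lemma cycle_gt0 : 0 < k. Proof. by case: Hc. Qed.

Lemma cycle_vertex_inj i j : i < k -> j < k -> same_vertex sigma (c i) (c j) -> i = j.
Proof.
case: Hc => _ _ H ik jk v; apply/eqP/negPn/negP => ij.
by case/and3P: (H i j ik jk ij); rewrite v.
Qed.

Lemma cycle_inj i j : i < k -> j < k -> c i = c j -> i = j.
Proof. by move=> ik jk E; apply: cycle_vertex_inj; rewrite // E /same_vertex connect0. Qed.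

Lemma cycle_opp i j : i < k -> j < k -> c i != alpha (c j).
Proof.
move=> ik jk; have [->|ij] := eqVneq j i; first by rewrite eq_sym.
by case: Hc => _ _ H; case/and3P: (H j i jk ik ij).
Qed.

Lemma cycle_succ i : i < k -> same_vertex sigma (alpha (c i)) (c (i.+1 %% k)).
Proof. by case: Hc => _ H _; apply: H. Qed.

Lemma card_cycle_darts : #|C| = 2 * k.
Proof.
have E : C = [set c (i : 'I_k) | i in 'I_k] :|: [set alpha (c (i : 'I_k)) | i in 'I_k].
  apply/setP=> x; rewrite in_setU; apply/cycle_dartsP/orP.
    by case=> i ik [->|->]; [left|right]; apply/imsetP; exists (Ordinal ik).
  by case=> /imsetP[i _ ->]; exists i => //; auto.
rewrite E cardsU !card_imset.
- rewrite !card_ord (_ : _ :&: _ = set0) ?cards0; first by lia.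
  apply/setP=> x; rewrite !inE; apply/negP=> /andP[/imsetP[i _ ->] /imsetP[j _ /eqP]].
  by rewrite (negPf (cycle_opp (ltn_ord i) (ltn_ord j))).
- by move=> i j /perm_inj/(cycle_inj (ltn_ord i) (ltn_ord j))/val_inj.
- by move=> i j /(cycle_inj (ltn_ord i) (ltn_ord j))/val_inj.
Qed.

Definition side (x y : T) := connect (glue alpha ph (~: C)) x y.

Lemma side_closedC : edge_closed (~: C).
Proof. exact/edge_closedC/cycle_darts_closed. Qed.

Lemma side_sym x y : side x y = side y x.
Proof. exact: glue_sym side_closedC x y. Qed.

Lemma side_trans x y z : side x y -> side y z -> side x z.
Proof. exact: connect_trans. Qed.

Lemma side_step x y z : glue alpha ph (~: C) y z -> side x z = side x y.
Proof. exact/connect_step/(glue_sym alphaK phI side_closedC). Qed.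

Lemma side_phi x y : side x (ph y) = side x y.
Proof. by apply: side_step; rewrite /glue eqxx. Qed.

Lemma side_alpha x y : y \notin C -> side x (alpha y) = side x y.
Proof. by move=> yC; apply: side_step; rewrite /glue inE yC eqxx orbT. Qed.

Lemma side_vertex x y z : same_vertex sigma y z ->
  (forall t, same_vertex sigma y t -> t \notin C) -> side x z = side x y.
Proof.
case/connectP=> p; elim: p y => [|t p IHp] y /=; first by move=> _ ->.
case/andP=> /eqP <- Hp Hz H; rewrite (IHp _ Hp Hz).
  rewrite -(phi_alpha sigma alphaK) side_phi side_alpha //; apply: H.
  exact: connect0.
by move=> s ys; apply: H; apply: connect_trans ys; exact: fconnect1.
Qed.

(** The only cycle darts at the vertex between steps [i] and [j] are [c j] and [alpha (c i)], and
    [sum_turn] around this vertex compares their sides. *)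
Lemma side_turn x i : i < k -> let j := i.+1 %% k in
  side x (c j) + side x (alpha (c i)) = side x (alpha (c j)) + side x (c i).
Proof.
move=> ik j; have jk : j < k by rewrite ltn_mod cycle_gt0.
pose K := [set y | same_vertex sigma (c j) y].
have SS : connect_sym (frel sigma) by apply: fconnect_sym; exact: perm_inj.
have Kai : same_vertex sigma (c j) (alpha (c i)) by rewrite /same_vertex SS; exact: cycle_succ.
have KC : K :&: C = [set c j; alpha (c i)].
  apply/setP=> y; rewrite in_setI in_set2 [y \in K]inE; apply/andP/orP.
    case=> Ky /cycle_dartsP[l lk [El|El]]; subst y.
      by left; rewrite (cycle_vertex_inj jk lk Ky).
    right; have /(cycle_vertex_inj jk) E : same_vertex sigma (c j) (c (l.+1 %% k)).
      exact: connect_trans Ky (cycle_succ lk).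
    have {}E : j = l.+1 %% k by apply: E; rewrite ltn_mod cycle_gt0.
    suff -> : i = l by [].
    move: E; rewrite /j.
    (* The successor modulo [k] is injective, so step [i] alone arrives at this vertex. *)
    have [ik'|ik'] := ltnP i.+1 k; have [lk'|lk'] := ltnP l.+1 k.
    - by rewrite !modn_small // => -[].
    - have -> : l.+1 = k by lia.
      by rewrite modnn modn_small.
    - have -> : i.+1 = k by lia.
      by rewrite modnn (modn_small lk').
    - lia.
  case=> /eqP->; rewrite ?Kai /same_vertex ?connect0; first by rewrite (cycle_mem jk).
  by rewrite (cycle_mem ik).
have := @sum_turn T alpha sigma alphaK K C (fun y => side x y) _ _ _; rewrite KC.
rewrite !big_setU1 ?inE ?cycle_opp //= !big_set1 alphaK => H.
symmetry; apply: H => [y|y|y /side_alpha->//]; last by rewrite side_phi.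
by rewrite !inE; apply/idP/idP => H; apply: connect_trans H _; rewrite ?fconnect1 // SS fconnect1.
Qed.

Lemma side_cut : ~~ side (c 0) (alpha (c 0)).
Proof.
have k0 := cycle_gt0; case: (Hmap) => _ _ Hcon He.
apply: (cut_edge alphaK alpha_neq Hcon He) => //.
- exact: cycle_darts_closed.
- by rewrite (cycle_mem k0).
have HD := edge_closedD cycle_darts_closed (edge_closed_edge alphaK (c 0)).
rewrite (glue_sym alphaK (@perm_inj _ sigma) HD).
(* The other edges of the cycle lead from the end of [c 0] back to its start, as [cut_edge]
   requires. *)
have H i : i < k -> connect (glue alpha sigma (C :\: edge (c 0))) (alpha (c 0)) (alpha (c i)).
  elim: i => [|i IHi] ik; first exact: connect0.
  have {}IHi := IHi (ltnW ik); apply: connect_trans IHi _.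
  apply: (@connect_trans _ _ (c i.+1)).
    apply: glue_orbit; have := cycle_succ (ltnW ik).
    by rewrite modn_small.
  apply: connect1; rewrite /glue eqxx 2!inE (cycle_mem ik) !inE /= andbT.
  rewrite negb_or (cycle_opp ik k0) andbT.
  by rewrite (_ : (c i.+1 == c 0) = false) ?orbT //; apply/negP=> /eqP/cycle_inj; lia.
have k1 : k.-1 < k by lia.
apply: connect_trans (H _ k1) _; apply: glue_orbit.
by have := cycle_succ k1; rewrite prednK // modnn.
Qed.

(** A dart lies in the face on its right, so [alpha (c i)] stands for the left of the cycle and
    [c i] for the right. With values 1 and 0 at step [i], the equation of [side_turn] has only the
    solution 1 and 0 at the next step. *)
Lemma side_left i : i < k -> side (alpha (c 0)) (alpha (c i)) && ~~ side (alpha (c 0)) (c i).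
Proof.
elim: i => [|i IHi] ik; first by rewrite {1}/side connect0 side_sym side_cut.
have /andP[] := IHi (ltnW ik).
have := side_turn (alpha (c 0)) (ltnW ik); rewrite /= modn_small //.
by do 4!case: side.
Qed.

Lemma side_right i : i < k -> side (c 0) (c i) && ~~ side (c 0) (alpha (c i)).
Proof.
elim: i => [|i IHi] ik; first by rewrite {1}/side connect0 side_cut.
have /andP[] := IHi (ltnW ik).
have := side_turn (c 0) (ltnW ik); rewrite /= modn_small //.
by do 4!case: side.
Qed.

(** The union of the two sides is closed under [ph] and [alpha], hence is everything by
    connectedness; [side_cut] makes the sides disjoint. *)
Lemma side_two y : side (c 0) y = ~~ side (alpha (c 0)) y.
Proof.
have [_ _ Hcon _] := Hmap.
pose M := [pred y | side (c 0) y || side (alpha (c 0)) y].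
have HM : M y.
  suff HA z : M z -> M (alpha z).
    apply: (connect_ind (P := fun z => M z) (connect_glue_phiT alphaK Hcon (c 0) y)).
      by rewrite /M /= /side connect0.
    move=> u v /orP[/eqP->|/andP[/eqP-> _]]; last exact: HA.
    by rewrite /M /= !side_phi.
  have [/cycle_dartsP[i ik [->|->]] _|zC] := boolP (z \in C).
  - by have /andP[H _] := side_left ik; rewrite /M /= H orbT.
  - by have /andP[H _] := side_right ik; rewrite /M /= alphaK H.
  - by rewrite /M /= !side_alpha.
case: (boolP (side (c 0) y)) HM => [E _|/negPf E]; last by rewrite /M /= E /= => ->.
by apply/esym/negP => E'; have := side_cut; rewrite (side_trans E) // side_sym.
Qed.

End Jordan.

(** * Girth and density of submaps *)

Section Girth.
Variables (T : finType) (alpha sigma : {perm T}).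
Hypothesis Hmap : is_map alpha sigma.

Local Notation ph := (phi alpha sigma).
Local Notation edge_closed := (edge_closed alpha).
Local Notation edge := (edge alpha).

Let alphaK : forall x, alpha (alpha x) = x. Proof. by case: Hmap. Qed.
Let alpha_neq : forall x, alpha x != x. Proof. by case: Hmap. Qed.
Let phI : injective ph := @phi_inj T alpha sigma.
Let Is : injective sigma := @perm_inj _ sigma.

Definition touched (A : {set T}) : {set T} :=
  [set x | [exists y in A, same_vertex sigma x y]].

Lemma touchedP (A : {set T}) x :
  reflect (exists2 y, y \in A & same_vertex sigma x y) (x \in touched A).
Proof. by rewrite inE; exact: (iffP exists_inP). Qed.

Lemma same_vertex_sym x y : same_vertex sigma x y = same_vertex sigma y x.
Proof. exact: fconnect_sym. Qed.

Lemma touched_vertex (A : {set T}) x y :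
  same_vertex sigma x y -> (x \in touched A) = (y \in touched A).
Proof.
move=> xy; apply/touchedP/touchedP => -[z zA xz]; exists z => //.
  by apply: connect_trans xz; rewrite [connect _ _ _]same_vertex_sym.
exact: connect_trans xy xz.
Qed.

Lemma sub_touched (A : {set T}) : A \subset touched A.
Proof. by apply/subsetP=> x xA; apply/touchedP; exists x => //; exact: connect0. Qed.

(** A vertex not touched by [A] is a component by itself and cancels in [ncomp_euler]. The touched
    part has at least one component. *)
Lemma euler_sub (A : {set T}) x : edge_closed A -> x \in A ->
  #|A| + 4 <= 2 * ncomp alpha ph (~: A) + 2 * fcard sigma (touched A).
Proof.
move=> HA xA; case: (Hmap) => _ _ Hcon He.
have := ncomp_euler alphaK alpha_neq Hcon He x HA.
have Sg := glue_sym alphaK Is HA.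
have Ss : connect_sym (frel sigma) by exact: fconnect_sym.
have Cs : fclosed sigma (touched A).
  by move=> y z /eqP<-; apply: touched_vertex; exact: fconnect1.
have Cg : closed (glue alpha sigma A) (touched A).
  apply: (intro_closed Sg) => y z /orP[/eqP->|/andP[/eqP-> yA] _].
    by rewrite (Cs y _ (eqxx _)).
  by apply: (subsetP (sub_touched A)); rewrite HA.
rewrite /ncomp (n_compC (touched A) (glue alpha sigma A)) (n_compC (touched A) (frel sigma)).
have -> : n_comp (glue alpha sigma A) [predC touched A] = fcard sigma [predC touched A].
  apply: n_comp_sub_eq => y yA z; apply/idP/idP; last exact: glue_orbit.
  move=> yz; suff /andP[] : (z \notin touched A) && fconnect sigma y z by [].
  apply: (connect_ind (P := fun z => _ : bool) yz); first by rewrite connect0 andbT.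
  move=> u v uv /andP[uA yu]; rewrite -(Cg _ _ uv) uA /=; apply: connect_trans yu _.
  case/orP: uv => [/eqP->|/andP[_ /(subsetP (sub_touched A))]]; first exact: fconnect1.
  by rewrite (negPf uA).
have := n_comp_gt0 Sg Cg (subsetP (sub_touched A) x xA).
by lia.
Qed.

(** Stop at the first [j] where the walk returns to the vertex of an earlier [s i]; the steps from
    [i] to [j] close up into a cycle. *)
Lemma walk_cycle (s : nat -> T) :
  (forall n, same_vertex sigma (alpha (s n)) (s n.+1)) ->
  (forall n, s n.+1 != alpha (s n)) ->
  exists i k, is_cycle alpha sigma k (fun m => s (i + m)).
Proof.
move=> sV sN; pose P j := [exists i : 'I_j, same_vertex sigma (s i) (s j)].
have exP : exists j, P j.
  pose f (i : 'I_#|T|.+1) := s i.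
  have /injectivePn[a [b ab fab]] : ~~ injectiveb f.
    apply/negP=> /injectiveP/leq_card; by rewrite card_ord ltnn.
  wlog lt_ab : a b ab fab / a < b.
    move=> W; have /orP[] : (a < b) || (b < a) by rewrite -neq_ltn.
      exact: W.
    by apply: W => //; rewrite eq_sym.
  exists b; apply/existsP; exists (Ordinal lt_ab) => /=.
  by move: fab; rewrite /f => ->; exact: connect0.
case: (ex_minnP exP) => j /existsP[[i ij] /= sij] jmin.
have dist a b : a < b -> b < j -> ~~ same_vertex sigma (s a) (s b).
  move=> ab bj; apply/negP=> sab; have : P b by apply/existsP; exists (Ordinal ab).
  by move/jmin; rewrite leqNgt bj.
have dist' a b : a != b -> a < j -> b < j -> ~~ same_vertex sigma (s a) (s b).
  by rewrite neq_ltn => /orP[] ab aj bj; [|rewrite same_vertex_sym]; apply: dist.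
exists i, (j - i); split; first by lia.
  move=> m mk; have [lt|ge] := ltnP m.+1 (j - i).
    by rewrite modn_small // addnS.
  have -> : m.+1 = j - i by lia.
  rewrite modnn addn0; apply: (@connect_trans _ _ (s j)); last first.
    by rewrite [connect _ _ _]same_vertex_sym.
  by have := sV (i + m); have -> : (i + m).+1 = j by lia.
move=> a b ak bk ab.
have nv : ~~ same_vertex sigma (s (i + a)) (s (i + b)) by apply: dist'; lia.
rewrite nv /=; apply/andP; split.
  by apply: contra nv => /eqP->; exact: connect0.
apply/eqP=> E.
(* If step [b] reverses step [a], it starts where [a] ends. The vertices being distinct, either [b]
   follows [a] directly, which is backtracking, or [a] is the last step and [b] the first; then step
   1 must be [a], which backtracks on step 0. *)
have [a1 | a1] := ltnP a.+1 (j - i).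
  have := sV (i + a); rewrite -E -addnS; apply/negP.
  have [E'|ba] := eqVneq b a.+1; last by apply: dist'; lia.
  by move: (sN (i + a)); rewrite -addnS -E' E eqxx.
have b0 : b = 0.
  apply/eqP; apply: contraT => b0.
  suff : same_vertex sigma (s (i + 0)) (s (i + b)).
    by apply: contraLR => _; apply: dist'; lia.
  rewrite addn0; apply: connect_trans sij _; rewrite E [connect _ _ _]same_vertex_sym.
  by have := sV (i + a); have -> : (i + a).+1 = j by lia.
move: E; rewrite b0 addn0 => E.
have := sV i; rewrite E alphaK; apply/negP.
have [E'|ne] := eqVneq i.+1 (i + a); last by rewrite same_vertex_sym; apply: dist'; lia.
by move: (sN i); rewrite E' E alphaK eqxx.
Qed.

Lemma card_ge_cycle k c (S : {set T}) : is_cycle alpha sigma k c ->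
  (forall i, i < k -> c i \in S) -> k <= #|S|.
Proof.
move=> Hc HS; rewrite -[X in X <= _]card_ord -(card_imset (f := fun i : 'I_k => c i)).
  by apply: subset_leq_card; apply/subsetP=> _ /imsetP[i _ ->]; apply: HS.
by move=> i j /(cycle_inj Hc (ltn_ord i) (ltn_ord j))/val_inj.
Qed.

Definition leaf (A : {set T}) x :=
  (x \in A) && [forall y in A, same_vertex sigma x y ==> (y == x)].

Lemma leafPn (A : {set T}) x : x \in A -> ~~ leaf A x ->
  exists y, [/\ y \in A, same_vertex sigma x y & y != x].
Proof.
by move=> xA; rewrite /leaf xA /= => /forall_inPn[y yA]; rewrite negb_imply => /andP[]; exists y.
Qed.

(** A leaf edge is a bridge, since no other dart of [A] leaves its end; [dual_connect] then says
    that removing it merges no regions. *)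
Lemma ncomp_leaf (A : {set T}) x : edge_closed A -> leaf A x ->
  ncomp alpha ph (~: (A :\: edge x)) = ncomp alpha ph (~: A).
Proof.
move=> HA /andP[xA /forall_inP lx]; have He := edge_closed_edge alphaK x.
have HD := edge_closedD HA He; have HC := edge_closedC HA.
have sE : edge x \subset A by apply/subsetP=> y; rewrite !inE => /orP[]/eqP->; rewrite ?HA.
have xD : x \notin A :\: edge x by rewrite !inE eqxx.
have nc : ~~ connect (glue alpha sigma (A :\: edge x)) x (alpha x).
  apply/negP=> c; have aA : alpha x \in A by rewrite HA.
  have /implyP H := lx _ aA.
  have /H : same_vertex sigma x (alpha x); last by rewrite (negPf (alpha_neq x)).
  apply: (connect_ind (P := same_vertex sigma x) c); first exact: connect0.
  move=> u v /orP[/eqP-> xu|/andP[_ uD] xu].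
    by apply: connect_trans xu _; exact: fconnect1.
  have uA : u \in A by move: uD; rewrite inE => /andP[].
  by have := implyP (lx u uA) xu => /eqP E; rewrite E (negPf xD) in uD.
have := dual_connect alphaK HD xD nc.
have -> : A :\: edge x :|: edge x = A by rewrite setUC -{2}(setID A (edge x)) (setIidPr sE).
by move/(ncomp_add_connected alphaK phI HC) => <-; rewrite setCD.
Qed.

(** A region without a dart of [A] could be left nowhere and would be the whole map, which contains
    [x0]. *)
Lemma region_meets (A : {set T}) x0 x : edge_closed A -> x0 \in A ->
  exists2 y, y \in A & connect (glue alpha ph (~: A)) x y.
Proof.
move=> HA x0A; case: (Hmap) => _ _ Hcon _.
pose M y := connect (glue alpha ph (~: A)) x y.
have [/existsP[y /andP[yA My]]|no] := boolP [exists y, (y \in A) && M y]; first by exists y.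
exists x0 => //; apply: (connect_ind (P := M) (connect_glue_phiT alphaK Hcon x x0)).
  by rewrite /M connect0.
move=> u v uv Mu; apply: connect_trans (Mu) _; apply: connect1; move: uv.
rewrite /glue !inE !andbT => /orP[->//|->]; apply/orP; right.
by apply: contra no => uA; apply/existsP; exists u; apply/andP.
Qed.

Section GirthBound.
Variable d : nat.
Hypothesis girth : forall k c, is_cycle alpha sigma k c -> d <= k.

(** Walk along the boundary of the region, turning at the end of each edge to the next dart of [A].
    Without leaves the walk never backtracks, so it contains a cycle, whose darts all lie in the
    region. *)
Lemma region_card (A : {set T}) x : edge_closed A -> (forall y, ~~ leaf A y) -> x \in A ->
  d <= #|[set y in A | connect (glue alpha ph (~: A)) x y]|.
Proof.
move=> HA nl xA; set S := [set _ in _ | _].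
have SE u v : glue alpha ph (~: A) u v ->
    connect (glue alpha ph (~: A)) x v = connect (glue alpha ph (~: A)) x u.
  exact/connect_step/(glue_sym alphaK phI (edge_closedC HA)).
pose Q u v := [&& v \in S, same_vertex sigma (alpha u) v & v != alpha u].
have ex u : u \in S -> exists v, Q u v.
  rewrite inE => /andP[uA xu]; set z := alpha u.
  have zA : z \in A by rewrite HA.
  have [y [yA zy yz]] := leafPn zA (nl z).
  (* The next boundary dart is found by the smallest positive number of rotations that reaches
     [A]. *)
  pose P n := (0 < n) && (iter n sigma z \in A).
  have Pf : P (findex sigma z y).
    by rewrite /P iter_findex // yA andbT lt0n findex_eq0 eq_sym.
  case: (ex_minnP (ex_intro P _ Pf)) => n /andP[n0 nA] nmin.
  have no : n < fingraph.order sigma z.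
    exact: leq_ltn_trans (nmin _ Pf) (findex_max zy).
  exists (iter n sigma z); rewrite /Q inE nA /= andbA andbC; apply/and3P; split.
  - apply/negP=> /eqP E; have := findex_iter no; rewrite E findex0; lia.
  (* The darts passed while rotating are off [A], so each rotation stays within the region. *)
  - suff H m : 0 < m <= n -> connect (glue alpha ph (~: A)) x (iter m sigma z).
      by apply: H; rewrite n0 leqnn.
    elim: m => // m IHm mn; rewrite iterS -(phi_alpha sigma alphaK) (SE (alpha (iter m sigma z))); last first.
      by rewrite /glue eqxx.
    case: m IHm mn => [|m] IHm mn; first by rewrite /= alphaK.
    rewrite (SE (iter m.+1 sigma z)); first by apply: IHm; lia.
    rewrite /glue eqxx orbC /= inE; apply/orP; left; apply/negP=> mA.
    by have := nmin m.+1; rewrite /P mA => /(_ isT); lia.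
  - exact: fconnect_iter.
pose step u := odflt u [pick v | Q u v].
have stepQ u : u \in S -> Q u (step u).
  by move/ex=> [v Qv]; rewrite /step; case: pickP => [//|/(_ v)]; rewrite Qv.
have sS n : iter n step x \in S.
  by elim: n => [|n /stepQ/and3P[]//]; rewrite inE xA connect0.
have [n|n|i [k Hk]] := @walk_cycle (fun n => iter n step x).
- by have /and3P[] := stepQ _ (sS n).
- by have /and3P[] := stepQ _ (sS n).
- by apply: leq_trans (girth Hk) (card_ge_cycle Hk _) => m _.
Qed.

Lemma region_bound (A : {set T}) x : edge_closed A -> (forall y, ~~ leaf A y) -> x \in A ->
  d * ncomp alpha ph (~: A) <= #|A|.
Proof.
move=> HA nl xA; set e := glue alpha ph (~: A).
have Se : connect_sym e := glue_sym alphaK phI (edge_closedC HA).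
rewrite -[X in _ <= X]sum1_card (partition_big (root e) (roots e)) /=; last first.
  by move=> y _; rewrite roots_root.
rewrite mulnC /ncomp /n_comp_mem -sum_nat_const.
rewrite (eq_bigl (roots e)); last by move=> y; rewrite !inE andbT.
apply: leq_sum => y /eqP ry; have [z zA yz] := region_meets y HA xA.
apply: leq_trans (region_card HA nl zA) _; rewrite sum1_card.
apply: subset_leq_card; apply/subsetP=> u; rewrite inE => /andP[uA zu].
apply/andP; split=> //.
by rewrite -ry root_connect // Se; apply: connect_trans zu.
Qed.

(** Peel off leaves: this keeps the regions and shrinks [A]. It ends with no edge at all, hence one
    region, or with a leafless set, for which [region_bound] applies. *)
Lemma region_dichotomy (A : {set T}) : edge_closed A ->
  ncomp alpha ph (~: A) = 1 \/ d * ncomp alpha ph (~: A) <= #|A|.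
Proof.
have [n] := ubnP #|A|; elim: n A => // n IHn A ltn HA; case: (Hmap) => _ _ Hcon _.
have [->|[x xA]] := set_0Vmem A.
  rewrite setC0 /ncomp; case: (pickP T) => [x _|no].
    by left; apply: (n_comp_eq1 (connect_glue_phiT alphaK Hcon) x).
  by right; rewrite /n_comp_mem (_ : #|predI _ _| = 0) ?muln0 //; apply: eq_card0 => x; have := no x.
have [/existsP[y ly]|/existsPn nl] := boolP [exists y, leaf A y]; last first.
  by right; apply: region_bound xA.
have yA : y \in A by case/andP: ly.
have lt : #|A :\: edge y| < #|A|.
  apply: proper_card; rewrite properE subsetDl /=; apply/subsetPn.
  by exists y; rewrite ?inE ?eqxx.
have := IHn _ (leq_trans lt _) (edge_closedD HA (edge_closed_edge alphaK y)).
rewrite (ncomp_leaf HA ly) => H; case: (H ltn) => [->|]; first by left.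
by right; lia.
Qed.

(** Combine [euler_sub] with an upper bound on the regions from [region_dichotomy]. The strictness
    is what yields accessibility. *)
Lemma density (A : {set T}) x : 1 < d -> edge_closed A -> x \in A ->
  (d - 2) * #|A| < 2 * (d * fcard sigma (touched A)).
Proof.
move=> d1 HA xA; have := euler_sub HA xA.
have -> : d = (d - 2).+2 by lia.
by case: (region_dichotomy HA); nia.
Qed.

(** Two regions exclude the first case of the dichotomy, and the constant 4 of Euler's formula
    survives as the gain [4 * d] needed for Hall's condition. *)
Lemma density_big (A : {set T}) x : 1 < d -> edge_closed A -> x \in A ->
  1 < ncomp alpha ph (~: A) ->
  (d - 2) * #|A| + 4 * d <= 2 * (d * fcard sigma (touched A)).
Proof.
move=> d1 HA xA; have := euler_sub HA xA.
have E : d = (d - 2).+2 by lia.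
by case: (region_dichotomy HA) => [->//|]; rewrite E; nia.
Qed.

End GirthBound.
End Girth.

(** * Face-rooted d-angulations *)

Section Dangulation.
Variables (T : finType) (alpha sigma : {perm T}) (d : nat) (r : T).
Hypothesis Hmap : is_map alpha sigma.
Hypothesis Hdang : is_dangulation alpha sigma d.

Local Notation ph := (phi alpha sigma).
Local Notation edge_closed := (edge_closed alpha).
Local Notation in_root := (in_root alpha sigma r).
Local Notation "x ~v y" := (same_vertex sigma x y) (at level 70).

Let alphaK : forall x, alpha (alpha x) = x. Proof. by case: Hmap. Qed.
Let phI : injective ph := @phi_inj T alpha sigma.
Let Is : injective sigma := @perm_inj _ sigma.
Let svS := same_vertex_sym sigma.

Lemma card_faces (a : {pred T}) : fclosed ph a -> d * fcard ph a = #|a|.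
Proof.
move=> ca; rewrite mulnC; apply: (fcard_order_set phI _ ca).
by apply/subsetP=> x _; rewrite !inE Hdang.
Qed.

Lemma sum_vertices (a : {pred T}) (w : T -> nat) : fclosed sigma a ->
  \sum_(y in a) w y = \sum_(x in predI (froots sigma) a) \sum_(y | x ~v y) w y.
Proof.
move=> ca; have Ss : connect_sym (frel sigma) by exact: fconnect_sym.
rewrite (partition_big (froot sigma) (mem (predI (froots sigma) a))) /=; last first.
  move=> y ya; rewrite inE /= roots_root //=.
  have := closed_connect ca (connect_root (frel sigma) y); rewrite ya => E.
  by apply: (etrans (esym E)).
apply: eq_bigr => x; rewrite inE => /andP[rx xa]; apply: eq_bigl => y.
have rx' := eqP rx; apply/andP/idP => [[_ /eqP E]|xy].
  by rewrite svS -E; exact: connect_root.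
rewrite -(closed_connect ca xy); split=> //.
by rewrite -[X in _ == X]rx' root_connect // -[connect _ _ _]svS.
Qed.

Lemma sum_vertices_const (a : {pred T}) (w : T -> nat) m : fclosed sigma a ->
  (forall x, x \in a -> \sum_(y | x ~v y) w y = m) ->
  \sum_(y in a) w y = m * fcard sigma a.
Proof.
move=> ca H; rewrite sum_vertices // mulnC /n_comp_mem -sum_nat_const.
by apply: eq_bigr => x; rewrite inE => /andP[_ /H].
Qed.

Lemma sum_edges_const (A : {set T}) (w : T -> nat) m : edge_closed A ->
  (forall x, x \in A -> w x + w (alpha x) = m) ->
  2 * \sum_(y in A) w y = m * #|A|.
Proof.
move=> HA H; rewrite mul2n -addnn -{1}(sum_alpha w HA) -big_split mulnC -sum_nat_const.
by apply: eq_bigr => x /H; rewrite addnC.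
Qed.

Lemma ncomp_gt1 (A : {set T}) k c : edge_closed A -> is_cycle alpha sigma k c ->
  cycle_darts alpha k c \subset A -> 1 < ncomp alpha ph (~: A).
Proof.
move=> HA Hc sCA.
have Se := glue_sym alphaK phI (edge_closedC HA).
have := side_cut Hmap Hc; rewrite /side => ns.
apply/card_gt1P; exists (root (glue alpha ph (~: A)) (c 0)), (root (glue alpha ph (~: A)) (alpha (c 0))).
rewrite !inE !roots_root //=; split=> //; rewrite root_connect //.
by apply: contra ns; apply: glue_mono; rewrite setCS.
Qed.

Lemma setT_closed : edge_closed setT. Proof. by move=> x; rewrite !inE. Qed.

(** * The contour of the root face *)

Section Contour.
Hypothesis girth : forall k c, is_cycle alpha sigma k c -> d <= k.

(** Removing a leaf edge would keep all the faces, and the dichotomy would bound [d] times their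
    number by [#|T| - 2], whereas this product equals [#|T|]. *)
Lemma no_leaf : 1 < fcard ph T -> forall y, ~~ leaf sigma setT y.
Proof.
move=> F1 y; apply/negP=> ly; have HD := edge_closedD setT_closed (edge_closed_edge alphaK y).
have := region_dichotomy Hmap girth HD; rewrite (ncomp_leaf Hmap setT_closed ly) setCT ncomp_set0.
rewrite (@card_faces T) => [|x z _]; last by rewrite !inE.
case=> [E|]; first by rewrite E in F1.
apply/negP; rewrite -ltnNge -cardsT; apply: proper_card; rewrite properE subsetDl /=.
by apply/subsetPn; exists y; rewrite ?inE ?eqxx.
Qed.

(** The walk around the root face does not backtrack, as that would exhibit a leaf. It contains a
    cycle of at most [d] root darts, which by the girth is the entire contour. *)
Lemma contour_cycle : 1 < fcard ph T ->
  exists2 r', in_root r' & is_cycle alpha sigma d (fun m => iter m ph r').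
Proof.
move=> F1; have nl := no_leaf F1.
have [n|n|i [k Hk]] := @walk_cycle T alpha sigma Hmap (fun n => iter n ph r).
- by rewrite iterS; exact: fconnect1.
- rewrite iterS /phi; apply/eqP; set z := alpha _ => E.
  have [y [_ zy /negP]] := leafPn (in_setT z) (nl z); apply.
  by case/connectP: zy => p; elim: p => [_ ->//|t p IHp] /= /andP[]; rewrite E => /eqP<-.
pose S := [set y | fconnect ph r y].
have kd : k <= d.
  have <- : #|S| = d by rewrite cardsE -(Hdang r).
  by apply: (card_ge_cycle Hk) => m _; rewrite inE; exact: fconnect_iter.
have Ek : k = d by apply/eqP; rewrite eqn_leq kd (girth Hk).
exists (iter i ph r); first exact: fconnect_iter.
rewrite -Ek; case: Hk => k0 H1 H2; split=> // [m mk|a b ak bk ab].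
  by have := H1 m mk; rewrite !(addnC i) !iterD.
by have := H2 a b ak bk ab; rewrite !(addnC i) !iterD.
Qed.

Lemma contour_simple : 1 < fcard ph T -> forall x y, in_root x -> in_root y -> x != y ->
  ~~ (x ~v y) && (y != alpha x).
Proof.
move=> F1 x y rx ry xy; have [r' rr' Hc] := contour_cycle F1.
have E z : in_root z -> exists2 m, m < d & z = iter m ph r'.
  move=> rz; have c' : fconnect ph r' z.
    by apply: connect_trans rz; rewrite fconnect_sym.
  by exists (findex ph r' z); [rewrite -(Hdang r') findex_max|rewrite iter_findex].
have [[a ad Ea] [b bd Eb]] := (E x rx, E y ry).
have ab : a != b by apply: contra xy => /eqP ab; rewrite Ea Eb ab.
by case: Hc => _ _ H; have /and3P[v _ ] := H a b ad bd ab; rewrite -Ea -Eb in v * => ->; rewrite v.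
Qed.

End Contour.
End Dangulation.

(** * Orientations bound the girth *)

Section OrientationGirth.
Variables (T : finType) (alpha sigma : {perm T}) (d : nat) (r : T).
Hypothesis Hmap : is_map alpha sigma.
Hypothesis Hd : 2 < d.
Hypothesis Hdang : is_dangulation alpha sigma d.

Local Notation ph := (phi alpha sigma).
Local Notation edge_closed := (edge_closed alpha).
Local Notation in_root := (in_root alpha sigma r).
Local Notation outer_vertex := (outer_vertex alpha sigma r).
Local Notation outer_edge := (outer_edge alpha sigma r).
Local Notation "x ~v y" := (same_vertex sigma x y) (at level 70).

Let alphaK : forall x, alpha (alpha x) = x. Proof. by case: Hmap. Qed.
Let phI : injective ph := @phi_inj T alpha sigma.
Let svS := same_vertex_sym sigma.


Variables (ing : T -> bool) (w : T -> nat).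
Hypothesis Hor : dd2_orientation alpha sigma r ing w d.

Lemma orientation_ing x : ing x = (0 < w x).
Proof.
case: Hor => /(_ x)[H1 H2] _; case: (boolP (ing x)) => [/H1->//|/H2->].
by rewrite ltnn.
Qed.

Lemma orientation_vertex x : vertex_weight sigma ing w x = \sum_(y | x ~v y) w y.
Proof.
rewrite /vertex_weight [RHS](bigID ing) /= [X in _ = _ + X]big1 ?addn0 //.
by move=> y /andP[_]; rewrite orientation_ing lt0n negbK => /eqP.
Qed.

Lemma outer_edge_vertex x : outer_edge x -> outer_vertex x.
Proof.
case/orP=> rx; apply/existsP.
  by exists x; rewrite rx; exact: connect0.
exists (sigma x); rewrite -(phi_alpha sigma alphaK) phi_alpha //.
apply/andP; split; last by rewrite svS; exact: fconnect1.
by apply: connect_trans rx _; rewrite -(phi_alpha sigma alphaK); exact: fconnect1.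
Qed.

Lemma disc_girth k c : is_cycle alpha sigma k c -> d <= k.
Proof.
move=> Hc; have cK := cycle_dartsP alpha k c; set C := cycle_darts alpha k c.
have HC : edge_closed C := cycle_darts_closed Hmap k c.
pose sd := side alpha sigma k c.
(* [z] represents the side away from the root face, the disc, and [z'] the other side. *)
have [z [z' [zr zz' zC]]] : exists z z', [/\ ~~ sd z r, forall y, sd z' y = ~~ sd z y &
    forall y, y \in C -> sd z (alpha y) = ~~ sd z y].
  have S2 := side_two Hmap Hc.
  have L y : y \in C -> sd (alpha (c 0)) (alpha y) = ~~ sd (alpha (c 0)) y.
    case/cK=> i ik; have /andP[H1 /negPf H2] := side_left Hmap Hc ik.
    by case=> ->; rewrite ?alphaK /sd H1 H2.
  have [rl|rl] := boolP (sd (alpha (c 0)) r).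
    exists (c 0), (alpha (c 0)); split.
    - by rewrite /sd S2 negbK.
    - by move=> y; rewrite /sd S2 negbK.
    - by move=> y /L H; rewrite {1}/sd S2 -/sd H /sd S2.
  by exists (alpha (c 0)), (c 0); split=> // y; rewrite /sd S2.
(* [I] holds the darts of the faces in the disc, [J] those of its interior edges; [A] adds the cycle
   to [J]. *)
pose I := [set y | sd z y]; pose J := I :\: C; pose A := J :|: C.
have IC y : y \notin C -> (alpha y \in I) = (y \in I).
  by move=> yC; rewrite !inE; exact: side_alpha.
have HJ : edge_closed J.
  move=> y; rewrite [LHS]in_setD [RHS]in_setD HC; apply: andb_id2l; exact: IC.
have HA : edge_closed A by apply: edge_closedU.
have Iph y : (ph y \in I) = (y \in I) by rewrite !inE; exact: side_phi.
have cI : fclosed ph I by move=> x y /eqP<-.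
have cC : #|C| = 2 * k := card_cycle_darts Hmap Hc.
(* Each cycle edge has exactly one dart in the disc. *)
have cIC : #|I :&: C| = k.
  have E : C :\: I = [set alpha x | x in I :&: C].
    apply/setP=> y; rewrite [LHS]in_setD; apply/andP/imsetP => [[yI yC]|[x]].
      exists (alpha y); rewrite ?alphaK // in_setI HC yC andbT inE zC //.
      by move: yI; rewrite inE.
    rewrite in_setI => /andP[xI xC] ->; rewrite HC inE zC // negbK.
    by split=> //; move: xI; rewrite inE.
  have := cardsID I C; rewrite E card_imset ?cC 1?setIC; first lia.
  exact: perm_inj.
have cJ : #|I| = #|J| + k by rewrite -(cardsID C I) cIC addnC.
have cA : #|A| = #|J| + 2 * k.
  rewrite cardsU cC (_ : J :&: C = set0) ?cards0 ?subn0 //.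
  by apply/setP=> y; rewrite in_setI in_setD in_set0 andbAC andNb.
have fI : d * fcard ph I = #|J| + k.
  by rewrite -cJ; apply: (card_faces Hdang).
(* Each face of the disc is a region of its own, and everything outside forms at most one more. *)
have fA : ncomp alpha ph (~: A) <= fcard ph I + 1.
  pose e := glue alpha ph (~: A).
  have Se : connect_sym e := glue_sym alphaK phI (edge_closedC HA).
  rewrite /ncomp (n_compC I) leq_add //.
    rewrite (@n_comp_sub_eq _ _ (frel ph)) // => u uI v.
    apply/idP/idP; last exact: glue_orbit.
    move=> uv; suff /andP[] : (v \in I) && fconnect ph u v by [].
    apply: (connect_ind (P := fun v => _ : bool) uv); first by rewrite uI; exact: connect0.
    move=> x y /orP[/eqP-> /andP[xI ux]|/andP[_ xA] /andP[xI _]].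
      by rewrite Iph xI; apply: connect_trans ux (fconnect1 _ _).
    by move: xA; rewrite in_setC in_setU in_setD xI andbT orNb.
  have Oe y : y \notin I -> connect e z' y.
    rewrite inE -zz' => sy.
    suff /andP[] : (sd z' y) && connect e z' y by [].
    apply: (connect_ind (P := fun v => _ : bool) sy); first by rewrite /sd /side !connect0.
    move=> u v uv /andP[su cu]; rewrite {1}/sd /side (connect_step _ _ uv); last first.
      exact: (glue_sym alphaK phI (edge_closedC HC)).
    rewrite -/(side alpha sigma k c z' u) -/(sd z' u) su; apply: connect_trans cu _; apply: connect1.
    move: uv; rewrite /e /glue => /orP[->//|/andP[->]]; rewrite !in_setC in_setU in_setD => uC.
    by rewrite uC (negPf uC) orbF inE -zz' su orbT.
  apply/card_le1P => x; rewrite inE => /andP[rx xI] y; rewrite inE; apply/andP/eqP.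
    case=> ry yI; apply/eqP; rewrite -[y](eqP ry) -[X in _ == X](eqP rx) root_connect //.
    by apply: connect_trans (Oe _ xI); rewrite Se; apply: Oe.
  by move=> ->.
(* The darts at the interior vertices of the disc. *)
pose U := [set y in I | y \notin touched sigma C].
have UJ : U \subset J.
  apply/subsetP=> y; rewrite inE in_setD => /andP[-> H]; rewrite andbT.
  by apply: contra H => yC; apply: (subsetP (sub_touched sigma C)).
have tC y : y \notin touched sigma C -> forall t, y ~v t -> t \notin C.
  by move=> yt t yv; apply: contra yt => tC; apply/touchedP; exists t.
have UE x y : x ~v y -> x \in U -> y \in U.
  move=> xy; rewrite inE => /andP[xI xt]; rewrite inE -(touched_vertex C xy) xt andbT.
  by move: xI; rewrite !inE /sd (side_vertex Hmap z xy (tC _ xt)).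
have cU : fclosed sigma U.
  move=> x y /eqP<-; apply/idP/idP; apply: UE; first exact: fconnect1.
  by rewrite svS; exact: fconnect1.
have noO x : x \in I -> in_root x = false.
  rewrite inE => sx; apply/negP=> rx; move/negP: zr; apply.
  apply: side_trans sx _; rewrite side_sym //; exact: glue_orbit.
have wU : \sum_(y in U) w y = d * fcard sigma U.
  apply: sum_vertices_const => // x xU; rewrite -orientation_vertex.
  case: Hor => _ /(_ x)[_ _ _]; apply; apply/existsP=> -[y /andP[ry yx]].
  have := UE x y; rewrite svS => /(_ yx xU); rewrite inE => /andP[yI _].
  by rewrite noO in ry.
have wJ : 2 * \sum_(y in J) w y = (d - 2) * #|J|.
  apply: sum_edges_const => // x xJ.
  case: Hor => _ /(_ x)[_ + _ _]; apply; rewrite /Defs.outer_edge.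
  have aJ : alpha x \in J by rewrite HJ.
  by move: xJ aJ; rewrite !in_setD => /andP[_ /noO->] /andP[_ /noO->].
(* Edges at interior vertices are interior, so the vertex weights there are paid by [J] alone. *)
have wUJ : \sum_(y in U) w y <= \sum_(y in J) w y.
  by rewrite [X in _ <= X](big_setID U) (setIidPr UJ) leq_addr.
have vA : fcard sigma (touched sigma A) <= fcard sigma U + k.
  pose R := [set froot sigma (c (i : 'I_k)) | i in 'I_k].
  have Rk : #|R| <= k by rewrite -[X in _ <= X]card_ord leq_imset_card.
  apply: leq_trans (leq_add (leqnn _) Rk); rewrite /n_comp_mem -!(cardsE (predI _ _)).
  apply: leq_trans (leq_of_leqif (leq_card_setU _ _)).
  apply: subset_leq_card; apply/subsetP=> x; rewrite in_setU inE => /andP[/eqP rx xA]; rewrite !inE.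
  case xt: (x \in touched sigma C).
    apply/orP; right; have [y /cK[i ik Hi] xy] := touchedP _ _ _ xt.
    have [j jk xj] : exists2 j, j < k & x ~v c j.
      case: Hi xy => ->; first by exists i.
      move=> xi; exists (i.+1 %% k); first by rewrite ltn_mod (cycle_gt0 Hc).
      by apply: connect_trans xi _; exact (cycle_succ Hc ik).
    apply/imsetP; exists (Ordinal jk) => //=; rewrite -rx; apply/eqP.
    by rewrite root_connect //; exact: fconnect_sym.
  have [y yA xy] := touchedP _ _ _ xA.
  have yC : y \notin C by apply: (tC x) => //; rewrite xt.
  apply/orP; left; apply/and3P; split; [exact/eqP| |by move: xt; rewrite inE => ->].
  move: yA; rewrite in_setU (negPf yC) orbF in_setD => /andP[_].
  by rewrite inE /sd (side_vertex Hmap z xy (tC _ (negbT xt))).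
have := euler_sub Hmap HA (x := c 0); rewrite cA.
have -> : c 0 \in A by rewrite in_setU (cycle_mem Hmap c (cycle_gt0 Hc)) orbT.
move/(_ isT) => Eu.
have H1 : #|J| + 2 <= 2 * (fcard ph I + fcard sigma U) by lia.
have H2 : 2 * (d * fcard sigma U) <= (d - 2) * #|J|.
  by rewrite -wU -wJ leq_mul.
(* Multiply Euler's inequality [H1] by [d], then eliminate faces by [fI] and vertices by [H2];
   [2 * d <= 2 * k] remains. *)
move: Hd fI H1 H2; set F := fcard ph I; set V := fcard sigma U; set j := #|J|.
have [e ->] : exists e, d = e.+2 by exists (d - 2); lia.
rewrite subSS subSS subn0 => _ E1 /(leq_mul (leqnn e.+2)) E2 E3.
rewrite -(leq_pmul2l (ltn0Sn 1)); nia.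
Qed.

(** With a single face everything is outer, and the weights count as many edges as vertices; by
    Euler's formula such a map has one vertex more than edges. *)
Lemma orientation_faces : 1 < fcard ph T.
Proof.
case: (Hmap) => _ _ Hcon He.
have F0 : 0 < fcard ph T.
  by apply: (n_comp_gt0 (x := r)) => //; exact: fconnect_sym.
rewrite ltn_neqAle F0 andbT eq_sym; apply/eqP=> F1.
have all_in x : in_root x.
  have Ss : connect_sym (frel ph) by exact: fconnect_sym.
  move: F1; rewrite /n_comp_mem => /eqP/card1P/= [z Hz].
  have Hr y : froot ph y = z.
    by have := Hz (froot ph y); rewrite !inE roots_root // => /esym/eqP.
  by rewrite /Defs.in_root /same_face -root_connect // !Hr.
have oE x : outer_edge x by rewrite /Defs.outer_edge all_in.
have E1 : 2 * \sum_(y in setT) w y = 1 * #|[set: T]|.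
  apply: sum_edges_const => [|x _]; first exact: setT_closed.
  by case: Hor => _ /(_ x)[+ _ _ _]; apply.
have E2 : \sum_(y in setT) w y = 1 * fcard sigma (mem [set: T]).
  apply: sum_vertices_const => [x y _|x _]; first by rewrite !inE.
  rewrite -orientation_vertex; case: Hor => _ /(_ x)[_ _ + _]; apply.
  exact: outer_edge_vertex.
have E3 : fcard sigma (mem [set: T]) = fcard sigma T.
  by apply: eq_n_comp_r => x; rewrite !inE.
rewrite cardsT in E1; lia.
Qed.

Lemma girth_of_orientation : girth_eq alpha sigma d.
Proof.
split; last exact: disc_girth.
have [r' _ Hc] := contour_cycle r Hmap Hdang disc_girth orientation_faces.
by exists (fun m => iter m ph r').
Qed.
End OrientationGirth.

(** * Flows *)

Section Flow.
Variables (T : finType) (alpha sigma : {perm T}).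
Hypothesis alphaK : forall x, alpha (alpha x) = x.
Hypothesis alpha_neq : forall x, alpha x != x.
Local Notation "x ~v y" := (same_vertex sigma x y) (at level 70).

Definition vsum (w : T -> nat) x := \sum_(y | x ~v y) w y.

Lemma same_vertex_eql x y z : x ~v y -> (x ~v z) = (y ~v z).
Proof.
move=> xy; apply/idP/idP; last exact: connect_trans xy.
by apply: (@connect_trans _ _ x) => //; rewrite [connect _ _ _]same_vertex_sym.
Qed.

Lemma vsum_eq w x y : x ~v y -> vsum w x = vsum w y.
Proof. by move=> xy; apply: eq_bigl => z; apply: same_vertex_eql. Qed.

Lemma sum_eq1 (P : pred T) u : \sum_(x | P x) (x == u : nat) = P u.
Proof.
rewrite big_mkcond (bigD1 u) //= eqxx big1 => [|x /negPf->]; last by rewrite if_same.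
by case: (P u).
Qed.

(* Moving one unit of weight along [alpha] requires a positive weight. *)
Definition residual (w : T -> nat) : rel T :=
  fun x y => (y == sigma x) || ((y == alpha x) && (0 < w x)).

(** Send one unit along the path. Crossing an edge lowers the weight of its first dart only, and a
    duplicate-free path does not come back to it, so the later steps remain residual. *)
Lemma push_path p u w : path (residual w) u p -> uniq (u :: p) ->
  exists w', (forall x, w' x + w' (alpha x) = w x + w (alpha x)) /\
    (forall z, vsum w' z + (z ~v u) = vsum w z + (z ~v last u p)).
Proof.
elim: p u w => [|y p IHp] u w; first by exists w.
rewrite [path _ _ _]/= [uniq _]/= => /andP[uy yp] /andP[up yUp].
rewrite [last _ _]/=; case/orP: uy => [/eqP Ey|/andP[/eqP Ey wu]].
  have [w' [H1 H2]] := IHp _ _ yp yUp; exists w'; split=> // z; rewrite -H2.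
  congr (_ + nat_of_bool _); rewrite Ey; exact (same_fconnect1_r (@perm_inj _ sigma) z u).
pose w1 x := w x + (x == y) - (x == u).
have uay : u != y by rewrite Ey eq_sym.
have w1E x : w1 x + (x == u) = w x + (x == y).
  by rewrite /w1; case: (x =P u) => [->|_]; rewrite ?(negPf uay) /=; lia.
have p1 : path (residual w1) y p.
  apply: (sub_in_path (P := predC1 u) (e := residual w)) yp; last first.
    apply/allP=> x xp; rewrite !inE; apply: contra up => /eqP<-; exact: xp.
  move=> x x'; rewrite !inE => xu _ /orP[xs|/andP[xs w0]]; apply/orP; [left|right] => //.
  by rewrite xs /w1 (negPf xu) /=; lia.
have [w' [H1 H2]] := IHp _ _ p1 yUp; exists w'; split=> [x|z].
  rewrite H1; have := w1E x; have := w1E (alpha x).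
  rewrite Ey (inj_eq perm_inj) (_ : (alpha x == u) = (x == alpha u)); first by lia.
  by apply/eqP/eqP => [<-|->]; rewrite alphaK.
have : vsum w1 z + (z ~v u) = vsum w z + (z ~v y).
  rewrite -!(sum_eq1 (fun x => z ~v x)) /vsum -!big_split.
  by apply: eq_bigr => x _; exact: w1E.
by have := H2 z; lia.
Qed.

Variables (dem beta : T -> nat).
Hypothesis dem_vertex : forall x y, x ~v y -> dem x = dem y.
Hypothesis beta_edge : forall x, beta (alpha x) = beta x.
Hypothesis total : \sum_x beta x = 2 * \sum_(x in froots sigma) dem x.
Hypothesis hall : forall B : {set T}, fclosed sigma B ->
  \sum_(x in B | alpha x \in B) beta x <=
  2 * \sum_(x in predI (froots sigma) (mem B)) dem x.

(** Augmenting paths: the total excess over the demands decreases until none is left, and a failure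
    to augment would violate [hall]. *)
Lemma flow : exists w, (forall x, w x + w (alpha x) = beta x) /\
  forall x, \sum_(y | x ~v y) w y = dem x.
Proof.
have Ss : connect_sym (frel sigma) by apply: fconnect_sym; exact: perm_inj.
have rootE x : x ~v froot sigma x by exact: connect_root.
(* Truncated subtraction: deficient vertices contribute 0 and cannot offset an excess. *)
pose exc w := \sum_(x in froots sigma) (vsum w x - dem x).
have wsum (B : {set T}) w : fclosed sigma B ->
    \sum_(x in B) w x = \sum_(x in predI (froots sigma) (mem B)) vsum w x.
  by move=> cB; exact: (sum_vertices w cB).
have setTE (F : T -> nat) : \sum_(x in predI (froots sigma) (mem [set: T])) F x =
    \sum_(x in froots sigma) F x.
  by apply: eq_bigl => x; rewrite !inE andbT.
suff H n w : exc w < n -> (forall x, w x + w (alpha x) = beta x) ->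
    exists w, (forall x, w x + w (alpha x) = beta x) /\ forall x, vsum w x = dem x.
  (* Initially one chosen dart of each edge carries its whole weight. *)
  pose w0 x := if x == froot alpha x then beta x else 0.
  apply: (H (exc w0).+1 w0) => // x; have Sa : connect_sym (frel alpha).
    by apply: fconnect_sym; exact: perm_inj.
  have E : froot alpha (alpha x) = froot alpha x.
    by apply/eqP; rewrite root_connect // Sa fconnect1.
  rewrite /w0 E beta_edge; set y := froot alpha x.
  have : (y == x) || (y == alpha x).
    have : fconnect alpha x y by exact: connect_root.
    move=> c; apply: (connect_ind (P := fun y => _ : bool) c); first by rewrite eqxx.
    by move=> u v /eqP<- /orP[]/eqP->; rewrite ?alphaK eqxx ?orbT.
  case/orP=> /eqP->; rewrite eqxx ?(negPf (alpha_neq x)) ?addn0 //.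
  by rewrite eq_sym (negPf (alpha_neq x)).
elim: n w => // n IHn w lt Hw.
have tot2 : 2 * \sum_(x in froots sigma) vsum w x = 2 * \sum_(x in froots sigma) dem x.
  rewrite -total -setTE -wsum; last by move=> x y _; rewrite !inE.
  have HT : edge_closed alpha setT by move=> x; rewrite !inE.
  rewrite mul2n -addnn -{1}(sum_alpha w HT) -big_split.
  by apply: eq_big => x; rewrite ?inE // => _; rewrite -Hw addnC.
have [/existsP[u /andP[ru Hu]]|/existsPn no] :=
    boolP [exists u, froots sigma u && (dem u < vsum w u)]; last first.
  (* No vertex exceeds its demand and the totals agree, so every demand is met exactly. *)
  exists w; split=> // x; rewrite (vsum_eq w (rootE x)) (dem_vertex (rootE x)).
  set y := froot sigma x; have ry : froots sigma y by apply: roots_root.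
  have le z : froots sigma z -> vsum w z <= dem z.
    by move=> rz; have := no z; rewrite rz /= -leqNgt.
  apply/eqP; rewrite eqn_leq le //=; move: tot2; rewrite (bigD1 y) //= [in RHS](bigD1 y) //=.
  have L a b s t : 2 * (a + s) = 2 * (b + t) -> s <= t -> b <= a by lia.
  by move/L; apply; apply: leq_sum => i /andP[ri _]; apply: le.
pose S := [set y | connect (residual w) u y].
have uS : u \in S by rewrite inE connect0.
have stepS x y : residual w x y -> x \in S -> y \in S.
  by rewrite !inE => xy ux; apply: connect_trans ux (connect1 xy).
have cS : fclosed sigma S.
  apply: (intro_closed Ss) => x y xy; apply: stepS.
  by rewrite /residual eq_sym [_ == _]xy.
have [/existsP[v /andP[vS Hv]]|/existsPn noS] :=
    boolP [exists v, (v \in S) && (vsum w v < dem v)].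
  (* A deficient vertex is reachable from the overloaded [u]: pushing one unit to it lowers the
     excess. *)
  move: (vS); rewrite inE => /connectP[p0 /shortenP[p pp up _] Ev].
  have [w' [H1 H2]] := push_path pp up.
  apply: (IHn w') => [|x]; last by rewrite H1.
  rewrite -Ev in H2.
  have nuv : (u ~v v) = false.
    apply/negP=> uv; move: Hu Hv; rewrite (vsum_eq w uv) (dem_vertex uv); lia.
  rewrite ltnS in lt; apply: leq_trans lt; rewrite /exc.
  rewrite (bigD1 u) //= [X in _ < X](bigD1 u) //= -addSn leq_add //.
    by have := H2 u; rewrite nuv /same_vertex connect0; lia.
  apply: leq_sum => x _; have := H2 x.
  case xv: (x ~v v); last by lia.
  by rewrite (vsum_eq w xv) (dem_vertex xv); lia.
have leS v : v \in S -> dem v <= vsum w v.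
  by move=> vS; have := noS v; rewrite vS /= -leqNgt.
(* Otherwise every vertex of [S] has at least its demand and [u] has more. No positive weight leads
   out of [S], so all this weight lies on edges inside [S], against [hall]. *)
have lt1 : \sum_(x in predI (froots sigma) (mem S)) dem x < \sum_(x in S) w x.
  rewrite wsum // (bigD1 u) ?inE ?ru //= [X in _ < X](bigD1 u) ?inE ?ru //=.
  by rewrite -addSn leq_add // leq_sum // => x; rewrite inE => /andP[/andP[_ /leS]].
pose A := [set x in S | alpha x \in S].
have HA : edge_closed alpha A by move=> x; rewrite !inE alphaK andbC.
have SA : \sum_(x in S) w x = \sum_(x in A) w x.
  rewrite (big_setID A) (setIidPr _) /=; last by apply/subsetP=> x; rewrite inE => /andP[].
  rewrite [X in _ + X]big1 ?addn0 // => x; rewrite in_setD [x \in A]inE => /andP[xA xS].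
  apply/eqP; rewrite eqn0Ngt; apply: contra xA => wx; rewrite xS /=.
  by apply: stepS xS; rewrite /residual eqxx wx orbT.
have := hall cS; have -> : \sum_(x in S | alpha x \in S) beta x = 2 * \sum_(x in A) w x.
  rewrite mul2n -addnn -{1}(sum_alpha w HA) -big_split.
  by apply: eq_big => x; rewrite ?inE // => _; rewrite -Hw addnC.
by rewrite -SA; lia.
Qed.

End Flow.

(** * Girth d gives an orientation *)

Section GirthOrientation.
Variables (T : finType) (alpha sigma : {perm T}) (d : nat) (r : T).
Hypothesis Hmap : is_map alpha sigma.
Hypothesis Hd : 2 < d.
Hypothesis Hdang : is_dangulation alpha sigma d.

Local Notation ph := (phi alpha sigma).
Local Notation edge_closed := (edge_closed alpha).
Local Notation in_root := (in_root alpha sigma r).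
Local Notation outer_vertex := (outer_vertex alpha sigma r).
Local Notation outer_edge := (outer_edge alpha sigma r).
Local Notation "x ~v y" := (same_vertex sigma x y) (at level 70).

Let alphaK : forall x, alpha (alpha x) = x. Proof. by case: Hmap. Qed.
Let alpha_neq : forall x, alpha x != x. Proof. by case: Hmap. Qed.
Let Is : injective sigma := @perm_inj _ sigma.
Let svS := same_vertex_sym sigma.



Hypothesis Hg : girth_eq alpha sigma d.
Let girth : forall k c, is_cycle alpha sigma k c -> d <= k. Proof. by case: Hg. Qed.

Lemma girth_faces : 1 < fcard ph T.
Proof.
have [[c Hc] _] := Hg.
by have := ncomp_gt1 Hmap (setT_closed alpha) Hc (subsetT _); rewrite setCT ncomp_set0.
Qed.

Let simple := contour_simple (r := r) Hmap Hdang girth girth_faces.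

Definition root_darts : {set T} := [set x | in_root x].
Definition outer_darts : {set T} := [set x | outer_edge x].
Definition outer_vertex_darts : {set T} := [set x | outer_vertex x].
Local Notation RO := root_darts.
Local Notation OE := outer_darts.
Local Notation OV := outer_vertex_darts.

Lemma outer_alpha x : in_root x -> in_root (alpha x) = false.
Proof.
move=> rx; apply/negP=> rax; have := simple rx rax.
by rewrite eq_sym alpha_neq eqxx andbF => /(_ isT).
Qed.

Lemma outer_edge_alpha x : outer_edge (alpha x) = outer_edge x.
Proof. by rewrite /Defs.outer_edge alphaK orbC. Qed.

Lemma outer_vertex_eq x y : x ~v y -> outer_vertex x = outer_vertex y.
Proof.
move=> xy; apply: eq_existsb => z; congr (_ && _).
by rewrite svS (same_vertex_eql _ xy) svS.
Qed.

Lemma root_outer_vertex x : in_root x -> outer_vertex x.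
Proof. by move=> rx; apply/existsP; exists x; rewrite rx; exact: connect0. Qed.

Lemma card_root_darts : #|RO| = d.
Proof. by rewrite cardsE -(Hdang r). Qed.

Lemma outer_dartsE (B : {set T}) : B :&: OE = (B :&: RO) :|: (B :&: (alpha @: RO)).
Proof.
rewrite -setIUr; congr (_ :&: _); apply/setP=> x; rewrite !inE; congr (_ || _).
apply/idP/imsetP => [rx|[y]]; last by rewrite inE => ry ->; rewrite alphaK.
by exists (alpha x); rewrite ?alphaK ?inE.
Qed.

Lemma card_outer_darts : #|OE| = 2 * d.
Proof.
rewrite -[OE]setTI outer_dartsE !setTI cardsU card_imset; last exact: perm_inj.
rewrite (_ : _ :&: _ = set0) ?cards0 ?card_root_darts; first by lia.
apply/setP=> x; rewrite !inE; apply/negP=> /andP[rx /imsetP[y]]; rewrite inE => ry E.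
by have := outer_alpha ry; rewrite -E rx.
Qed.

Definition vertices : {set T} := [set x in froots sigma].

Lemma fcardE (B : {set T}) : fcard sigma B = #|vertices :&: B|.
Proof. by apply: eq_card => x; rewrite !inE. Qed.

Lemma froot_vertex x : x ~v froot sigma x. Proof. exact: connect_root. Qed.

(** As the contour is simple, each outer vertex carries exactly one root dart. *)
Lemma card_outer_vertices (B : {set T}) : fclosed sigma B ->
  #|vertices :&: (B :&: OV)| = #|B :&: RO|.
Proof.
move=> cB; have Ss : connect_sym (frel sigma) by exact: fconnect_sym.
have -> : vertices :&: (B :&: OV) = froot sigma @: (B :&: RO).
  apply/setP=> x; rewrite !inE; apply/andP/imsetP => [[/eqP rx /andP[xB /existsP[y /andP[ry yx]]]]|[y]].
    exists y; first by rewrite !inE ry andbT (closed_connect cB yx).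
    by apply/eqP; rewrite -rx root_connect // Ss.
  rewrite !inE => /andP[yB ry] ->; rewrite roots_root // -(closed_connect cB (froot_vertex y)).
  by rewrite yB -(outer_vertex_eq (froot_vertex y)) root_outer_vertex.
apply: card_in_imset => x y; rewrite !inE => /andP[_ rx] /andP[_ ry] /eqP.
rewrite root_connect // => xy; apply/eqP/negPn/negP => /(simple rx ry).
by rewrite /same_vertex xy.
Qed.

Let dem x := if outer_vertex x then 1 else d.
Let beta x := if outer_edge x then 1 else d - 2.

Lemma sum_two (A X : {set T}) a b : b <= a ->
  \sum_(x in A) (if x \in X then b else a) + (a - b) * #|A :&: X| = a * #|A|.
Proof.
move=> ab; rewrite (big_setID X) /= (eq_bigr (fun=> b)) => [|x]; last first.
  by rewrite in_setI => /andP[_ ->].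
rewrite [X in _ + X + _](eq_bigr (fun=> a)) => [|x]; last first.
  by rewrite in_setD => /andP[/negPf-> _].
by rewrite !sum_nat_const -(cardsID X A); nia.
Qed.

Lemma sum_dem (B : {set T}) : fclosed sigma B ->
  \sum_(x in predI (froots sigma) (mem B)) dem x + (d - 1) * #|B :&: RO| = d * fcard sigma B.
Proof.
move=> cB; rewrite -card_outer_vertices // fcardE setIA.
rewrite -(@sum_two _ OV d 1); last by lia.
by congr (_ + _); apply: eq_big => x; rewrite !inE.
Qed.

Lemma sum_beta (A : {set T}) :
  \sum_(x in A) beta x + (d - 3) * #|A :&: OE| = (d - 2) * #|A|.
Proof.
rewrite -(@sum_two A OE (d - 2) 1); last by lia.
have -> : d - 2 - 1 = d - 3 by lia.
by congr (_ + _); apply: eq_bigr => x; rewrite inE.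
Qed.

(** Add all outer edges to the edges [A] inside [B]: the contour then supplies a second region and
    [density_big] applies. With [q] outer vertices in [B], this adds at most [d - q] vertices, and
    [A] has at most [2 * q] outer darts. *)
Lemma hall_condition (B : {set T}) : fclosed sigma B ->
  \sum_(x in B | alpha x \in B) beta x <=
  2 * \sum_(x in predI (froots sigma) (mem B)) dem x.
Proof.
move=> cB; pose A := [set x in B | alpha x \in B].
rewrite (eq_bigl (mem A)); last by move=> x; rewrite !inE.
have HA : edge_closed A by move=> x; rewrite !inE alphaK andbC.
have HO : edge_closed OE by move=> x; rewrite !inE outer_edge_alpha.
have HU := edge_closedU HA HO.
have [r' rr' Hc] := contour_cycle r Hmap Hdang girth girth_faces.
have sC : cycle_darts alpha d (fun m => iter m ph r') \subset A :|: OE.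
  apply/subsetP=> x /cycle_dartsP[i id Hi]; rewrite in_setU; apply/orP; right.
  have ri : in_root (iter i ph r') by apply: connect_trans rr' (fconnect_iter _ _ _).
  by case: Hi => -> /=; rewrite inE /Defs.outer_edge ?alphaK ri ?orbT.
have r'U : r' \in A :|: OE by rewrite !inE /Defs.outer_edge rr' orbT.
have := density_big Hmap girth (ltnW Hd) HU r'U (ncomp_gt1 Hmap HU Hc sC).
have cOV : fclosed sigma OV.
  by move=> x y /eqP<-; rewrite !inE; apply: outer_vertex_eq; exact: fconnect1.
have Vle : fcard sigma (touched sigma (A :|: OE)) + #|B :&: RO| <= fcard sigma B + d.
  have := card_outer_vertices (B := setT); rewrite !setTI card_root_darts => VO.
  have {}VO : #|vertices :&: OV| = d by apply: VO => x y _; rewrite !inE.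
  rewrite !fcardE -card_outer_vertices // -VO setIIr -(cardsUI (vertices :&: B)) -setIUr leq_add2r.
  apply: subset_leq_card; apply: setIS; apply/subsetP=> x /touchedP[y + xy].
  rewrite in_setU => /orP[|]; rewrite [y \in _]inE => H; rewrite in_setU; apply/orP; [left|right].
    by rewrite (closed_connect cB xy); case/andP: H.
  by rewrite inE (outer_vertex_eq xy) outer_edge_vertex.
have Uc : #|A :|: OE| + #|A :&: OE| = #|A| + 2 * d by rewrite cardsUI card_outer_darts.
have m2q : #|A :&: OE| <= 2 * #|B :&: RO|.
  rewrite outer_dartsE mul2n -addnn; apply: leq_trans (leq_of_leqif (leq_card_setU _ _)) _.
  have sAB : A \subset B by apply/subsetP=> x; rewrite inE => /andP[].
  apply: leq_add; first exact/subset_leq_card/setSI.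
  rewrite -[X in _ <= X](card_imset _ (@perm_inj _ alpha)); apply: subset_leq_card.
  apply/subsetP=> x /setIP[xA /imsetP[y yR Ex]]; apply/imsetP; exists y => //.
  by rewrite in_setI yR andbT; move: xA; rewrite inE Ex alphaK => /andP[].
have := sum_beta A; have := sum_dem cB.
move: (\sum_(x in predI _ _) dem x) (\sum_(x in mem A) beta x) Vle Uc m2q.
move: (fcard sigma B) (fcard sigma (touched _ _)) #|B :&: RO| #|A :&: OE| #|A :|: OE| #|A|.
move=> V V' q m a' a sd sb Vle Uc m2q Ed Eb D.
have [e Ee] : exists e, d = e.+3 by exists (d - 3); lia.
move: Ed Eb D Vle Uc; rewrite Ee !subSS !subn0 => Ed Eb D Vle Uc.
(* Here [e.+3] is [d] and [e.+1] is [d - 2]. After substitution the claim reduces to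
   [m <= 2 * q]. *)
have Vle' : e.+3 * (V' + q) <= e.+3 * (V + e.+3) by rewrite leq_mul.
have Uc' : e.+1 * (a' + m) = e.+1 * (a + 2 * e.+3) by rewrite Uc.
have := m2q.
nia.
Qed.

(** This is Euler's formula multiplied by [d], with faces counted by [card_faces], after the
    corrections for the [d] outer edges and [d] outer vertices. *)
Lemma total_condition : \sum_x beta x = 2 * \sum_(x in froots sigma) dem x.
Proof.
have cT : fclosed sigma [set: T] by move=> x y _; rewrite !inE.
have := sum_beta [set: T]; have := sum_dem cT.
rewrite !setTI card_root_darts card_outer_darts cardsT.
have -> : fcard sigma (mem [set: T]) = fcard sigma T.
  by apply: eq_n_comp_r => x; rewrite !inE.
have -> : \sum_(x in predI (froots sigma) (mem [set: T])) dem x = \sum_(x in froots sigma) dem x.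
  by apply: eq_bigl => x; rewrite !inE andbT.
have -> : \sum_(x in [set: T]) beta x = \sum_x beta x.
  by apply: eq_bigl => x; rewrite inE.
have cF : fclosed ph T by move=> x y _; rewrite !inE.
have := card_faces Hdang cF; have [_ _ _ He] := Hmap.
have : d * (2 * fcard sigma T + 2 * fcard ph T) = d * (#|T| + 4) by rewrite He.
move: (\sum_x _) (\sum_(x in _) _) (fcard ph T) (fcard sigma T) #|T| => a b F V t.
have [e ->] : exists e, d = e.+3 by exists (d - 3); lia.
rewrite !subSS !subn0; nia.
Qed.

Lemma orientation_exists : exists ing w, dd2_orientation alpha sigma r ing w d.
Proof.
have Hb x : beta (alpha x) = beta x by rewrite /beta outer_edge_alpha.
have Hdm x y : x ~v y -> dem x = dem y by move=> xy; rewrite /dem (outer_vertex_eq xy).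
have [w [He Hv]] := flow alphaK alpha_neq Hdm Hb total_condition hall_condition.
exists (fun x => 0 < w x), w; split=> x; first by split=> //; rewrite lt0n negbK => /eqP.
have Ev : vertex_weight sigma (fun x => 0 < w x) w x = dem x.
  rewrite -Hv /vertex_weight [RHS](bigID (fun y => 0 < w y)) /= [X in _ = _ + X]big1 ?addn0 //.
  by move=> y /andP[_]; rewrite lt0n negbK => /eqP.
have Ee : edge_weight alpha w x = beta x := He x.
by rewrite Ev Ee /dem /beta; split=> [->|/negPf->|->|/negPf->].
Qed.

End GirthOrientation.

(** * Existence of minimal orientations *)

Section MinimalOrientation.
Variables (T : finType) (alpha sigma : {perm T}) (d : nat) (r : T).
Hypothesis Hmap : is_map alpha sigma.
Hypothesis Hdang : is_dangulation alpha sigma d.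

Local Notation ph := (phi alpha sigma).
Local Notation edge := (edge alpha).
Local Notation "x ~v y" := (same_vertex sigma x y) (at level 70).

Let alphaK : forall x, alpha (alpha x) = x. Proof. by case: Hmap. Qed.
Let svS := same_vertex_sym sigma.



(** * Reversing a circuit *)

Section Reversal.
Variables (ing : T -> bool) (w : T -> nat) (k : nat) (c : nat -> T).
Hypothesis Hor : dd2_orientation alpha sigma r ing w d.
Hypothesis Hc : is_circuit alpha sigma ing k c.
Let Hcy : is_cycle alpha sigma k c. Proof. by case: Hc. Qed.

Let X : {set T} := [set c (i : 'I_k) | i in 'I_k].
(** On each circuit edge one unit moves from the ingoing dart [alpha (c i)] to [c i]; the
    subtraction is exact because ingoing darts have positive weight. *)
Definition reversal x := w x + (x \in X) - (alpha x \in X).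

Lemma reversalE x : reversal x + (alpha x \in X) = w x + (x \in X).
Proof.
rewrite /reversal subnK //; case: imsetP => [[i _ E]|//].
have : 0 < w x; last by lia.
by rewrite -(orientation_ing Hor) -[x]alphaK E; case: Hc => _; apply.
Qed.

Lemma sum_circuit (F : T -> nat) : \sum_(x in X) F x = \sum_(i < k) F (c i).
Proof.
rewrite big_imset //= => i j _ _ /(cycle_inj Hcy (ltn_ord i) (ltn_ord j)); exact: val_inj.
Qed.

Lemma sum_circuit_alpha (F : T -> nat) :
  \sum_(x | alpha x \in X) F x = \sum_(i < k) F (alpha (c i)).
Proof.
rewrite -(sum_circuit (fun x => F (alpha x))) [RHS](reindex_inj (@perm_inj _ alpha)).
by apply: eq_bigr => x _; rewrite alphaK.
Qed.

Lemma reversal_vsum x : vsum sigma reversal x = vsum sigma w x.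
Proof.
have : vsum sigma reversal x + \sum_(y | x ~v y) (alpha y \in X) =
    vsum sigma w x + \sum_(y | x ~v y) (y \in X).
  by rewrite /vsum -!big_split; apply: eq_bigr => y _; exact: reversalE.
have -> : \sum_(y | x ~v y) (y \in X) = \sum_(i < k) (x ~v c i).
  rewrite -(sum_circuit (fun y => (x ~v y : nat))) !(big_mkcond _ (fun y => nat_of_bool _)).
  by rewrite [LHS]big_mkcond; apply: eq_bigr => y _; case: (x ~v y); case: (y \in X).
have -> : \sum_(y | x ~v y) (alpha y \in X) = \sum_(i < k) (x ~v alpha (c i)).
  rewrite -(sum_circuit_alpha (fun y => (x ~v y : nat))) [RHS]big_mkcond [LHS]big_mkcond.
  by apply: eq_bigr => y _; case: (x ~v y); case: (alpha y \in X).
(* A step ends where the next one starts: shift the index cyclically. *)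
have -> : \sum_(i < k) (x ~v alpha (c i)) = \sum_(i < k) (x ~v c i).
  rewrite [RHS](reindex_inj (@ordS_inj k)); apply: eq_bigr => i _; congr nat_of_bool.
  by rewrite svS [RHS]svS; apply: same_vertex_eql; apply: (cycle_succ Hcy).
by move/addIn.
Qed.

Lemma reversal_orientation : dd2_orientation alpha sigma r (fun x => 0 < reversal x) reversal d.
Proof.
have Hv x : vertex_weight sigma (fun x => 0 < reversal x) reversal x = vertex_weight sigma ing w x.
  rewrite (orientation_vertex Hor) -[RHS]reversal_vsum.
  rewrite /vertex_weight [RHS](bigID (fun y => 0 < reversal y)) /= [X in _ = _ + X]big1 ?addn0 //.
  by move=> y /andP[_]; rewrite lt0n negbK => /eqP.
have He x : edge_weight alpha reversal x = edge_weight alpha w x.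
  have := reversalE x; have := reversalE (alpha x); rewrite alphaK /edge_weight; lia.
split=> x; first by split=> //; rewrite lt0n negbK => /eqP.
by rewrite Hv He; case: Hor => _.
Qed.

Lemma reversal_sum (F : T -> nat) :
  \sum_x F x * reversal x + \sum_(i < k) F (alpha (c i)) =
  \sum_x F x * w x + \sum_(i < k) F (c i).
Proof.
rewrite -sum_circuit -sum_circuit_alpha !(big_mkcond (fun x => _ \in _)) -!big_split /=.
apply: eq_bigr => x _; have := reversalE x.
by case: (_ \in _); case: (_ \in _) => /= E; nia.
Qed.

End Reversal.

(** * A potential decreased by reversing counterclockwise circuits *)

Section Potential.
Variable h : T -> nat.
Hypothesis hP : forall x, x != r -> exists2 y, glue alpha ph setT y x & h y < h x.

Let D := \max_x h x.
(** Only darts whose opposite is closer to the root count, and more so the closer they are. The base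
    exceeds the length of any circuit, so one term outweighs a whole circuit of terms with smaller
    exponents. *)
Let pot x := (h (alpha x) < h x) * #|T|.+1 ^ (D.+1 - h x).

(* The leading term is the edge through which the inner face closest to the
   root face is left: it contributes to the left-hand darts of the circuit
   only, and everything on the right has a strictly smaller exponent. *)
Lemma potential_circuit ing k c : counterclockwise alpha sigma r ing k c ->
  \sum_(i < k) pot (c i) < \sum_(i < k) pot (alpha (c i)).
Proof.
case=> -[Hc _] nr; have cK := cycle_dartsP alpha k c.
pose s := side alpha sigma k c (alpha (c 0)).
have sr : ~~ s r.
  apply: contra nr; rewrite /root_on_left (eq_connect (region_relE _ _ _ _)).
  rewrite -(phi_alpha sigma alphaK) => sr; apply: side_trans sr.
  by rewrite side_sym // side_phi // /side connect0.
have s0 : s (alpha (c 0)) by rewrite /s /side connect0.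
case: (arg_minnP h s0) => x sx xmin.
(* The predecessor [y] of the closest left-hand dart [x] is closer still, hence on the right; the
   step from [y] to [x] must cross the cycle. *)
have [y yx hyx] : exists2 y, glue alpha ph setT y x & h y < h x.
  by apply: hP; apply: contraNneq sr => <-.
have sy : ~~ s y by apply: contraL hyx => /xmin; rewrite -leqNgt.
have Ex : x = alpha y.
  by case/orP: yx => [/eqP Ex|/andP[/eqP-> //]]; move: sx; rewrite Ex /s side_phi // -/(s y) (negPf sy).
have [i ik Ey] : exists2 i, i < k & y = c i.
  have : y \in cycle_darts alpha k c.
    by apply: contraT => yC; move: sx; rewrite Ex /s side_alpha // -/(s y) (negPf sy).
  case/cK=> i ik [->|E]; first by exists i.
  by move: sy; rewrite E /s; have /andP[-> _] := side_left Hmap Hc ik.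
have hD z : h z <= D by exact: leq_bigmax.
have kT : k <= #|T| by rewrite -cardsT; apply: (card_ge_cycle Hc) => j _; rewrite inE.
apply: (@leq_trans (#|T|.+1 ^ (D.+1 - h x))); last first.
  rewrite (bigD1 (Ordinal ik)) //= -Ey -Ex {1}/pot Ex alphaK -Ex hyx mul1n leq_addr //.
have -> : D.+1 - h x = (D - h x).+1 by rewrite subSn.
apply: (@leq_ltn_trans (k * #|T|.+1 ^ (D - h x))); last first.
  by rewrite expnS ltn_mul2r expn_gt0.
rewrite -[X in X * _]card_ord -sum_nat_const; apply: leq_sum => j _; rewrite /pot.
(* [alpha (c j)] is on the left, so it is no closer than [x]; a counted [c j] is strictly farther
   and its exponent is at most [D - h x]. *)
case: ltnP => // hj; rewrite mul1n leq_pexp2l //.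
have /xmin : s (alpha (c j)) by have /andP[] := side_left Hmap Hc (ltn_ord j).
lia.
Qed.

Lemma minimal_of_potential ing w : dd2_orientation alpha sigma r ing w d ->
  exists ing' w', dd2_orientation alpha sigma r ing' w' d /\ minimal alpha sigma r ing'.
Proof.
have [n] := ubnP (\sum_x pot x * w x); elim: n ing w => // n IHn ing w lt Hor.
have [m|nm] := classic (minimal alpha sigma r ing); first by exists ing, w.
have [k [c Hc]] : exists k c, counterclockwise alpha sigma r ing k c.
  by apply: NNPP => no; apply: nm => k c Hc; apply: no; exists k, c.
have Hci : is_circuit alpha sigma ing k c by case: Hc.
apply: IHn (reversal_orientation Hor Hci).
have := reversal_sum Hor Hci pot; have := potential_circuit Hc; lia.
Qed.

End Potential.

Lemma minimal_exists ing w : dd2_orientation alpha sigma r ing w d ->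
  exists ing' w', dd2_orientation alpha sigma r ing' w' d /\ minimal alpha sigma r ing'.
Proof.
case: (Hmap) => _ _ Hcon _.
have [h hP] := connect_rank (connect_glue_phiT alphaK Hcon r).
exact: minimal_of_potential hP _ _.
Qed.

End MinimalOrientation.

(** * Minimal orientations *)

Section MinimalProperties.
Variables (T : finType) (alpha sigma : {perm T}) (d : nat) (r : T).
Hypothesis Hmap : is_map alpha sigma.
Hypothesis Hd : 2 < d.
Hypothesis Hdang : is_dangulation alpha sigma d.

Local Notation ph := (phi alpha sigma).
Local Notation edge_closed := (edge_closed alpha).
Local Notation in_root := (in_root alpha sigma r).
Local Notation outer_vertex := (outer_vertex alpha sigma r).
Local Notation outer_edge := (outer_edge alpha sigma r).
Local Notation "x ~v y" := (same_vertex sigma x y) (at level 70).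

Let alphaK : forall x, alpha (alpha x) = x. Proof. by case: Hmap. Qed.
Let phI : injective ph := @phi_inj T alpha sigma.
Let Is : injective sigma := @perm_inj _ sigma.
Let svS := same_vertex_sym sigma.



Hypothesis Hg : girth_eq alpha sigma d.
Let girth : forall k c, is_cycle alpha sigma k c -> d <= k. Proof. by case: Hg. Qed.
Let F1 : 1 < fcard ph T := girth_faces Hmap Hg.
Let simple := contour_simple (r := r) Hmap Hdang girth F1.

Variables (ing : T -> bool) (w : T -> nat).
Hypothesis Hor : dd2_orientation alpha sigma r ing w d.
Hypothesis Hmin : minimal alpha sigma r ing.

Let ingE : forall x, ing x = (0 < w x) := orientation_ing Hor.

Lemma outer_edge_ing x : outer_edge x ->
  [&& ing x != ing (alpha x), w x == ing x & w (alpha x) == ing (alpha x)].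
Proof.
move=> ox; case: Hor => _ /(_ x)[/(_ ox) + _ _ _]; rewrite /edge_weight !ingE.
by case: (w x) (w (alpha x)) => [|[|?]] [|[|?]].
Qed.

Lemma outer_vertex_sum x : outer_vertex x -> \sum_(y | x ~v y) w y = 1.
Proof. by move=> ox; rewrite -(orientation_vertex Hor); case: Hor => _ /(_ x)[_ _ /(_ ox)]. Qed.

Lemma root_not_alpha x : in_root x -> in_root (alpha x) = false.
Proof. exact: (outer_alpha Hmap Hdang Hg). Qed.

(** The ingoing dart [alpha x] uses up the total weight 1 of the outer vertex, so [ph x] is outgoing
    there and its 1-way edge points forward. *)
Lemma contour_forward x : in_root x -> ing (alpha x) -> ing (alpha (ph x)).
Proof.
move=> rx ix; have rp : in_root (ph x) by apply: connect_trans rx (fconnect1 _ _).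
have v : ph x ~v alpha x by rewrite svS; exact: fconnect1.
have := outer_vertex_sum (root_outer_vertex rp).
rewrite (bigD1 (ph x)) /=; last exact: connect0.
rewrite (bigD1 (alpha x)) /=; last first.
  by rewrite v; apply: contraTneq rp => <-; rewrite root_not_alpha.
have := @outer_edge_ing (ph x); rewrite /Defs.outer_edge rp => /(_ isT).
by move: ix; rewrite !ingE; case: (w (alpha x)) (w (ph x)) => [|?] [|?] //=; lia.
Qed.

(** One forward contour edge makes all of them forward by [contour_forward]. The contour would be a
    circuit with the root face on its right, that is, counterclockwise. *)
Lemma contour_backward x : in_root x -> ing x && ~~ ing (alpha x).
Proof.
move=> rx; have ox : outer_edge x by rewrite /Defs.outer_edge rx.
have /and3P[ne _ _] := outer_edge_ing ox.
suff nf : ~~ ing (alpha x) by rewrite nf andbT; move: ne; rewrite (negPf nf); case: (ing x).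
apply/negP=> fx; have [r' rr' Hc] := contour_cycle r Hmap Hdang girth F1.
have F m : in_root (iter m ph x) && ing (alpha (iter m ph x)).
  elim: m => [|m /andP[rm fm]]; first by rewrite rx.
  by rewrite iterS contour_forward // andbT; apply: connect_trans rm (fconnect1 _ _).
have fall m : ing (alpha (iter m ph r')).
  have xr : fconnect ph x (iter m ph r').
    apply: (@connect_trans _ _ r); first by rewrite fconnect_sym.
    by apply: connect_trans rr' (fconnect_iter _ _ _).
  by rewrite -(iter_findex xr); have /andP[] := F (findex ph x (iter m ph r')).
apply: (Hmin (k := d) (c := fun m => iter m ph r')); split; first by split.
rewrite /root_on_left /= (eq_connect (region_relE _ _ _ _)) -(phi_alpha sigma alphaK).
have := side_left Hmap Hc (cycle_gt0 Hc) => /= /andP[_]; apply: contra => rl.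
rewrite side_sym //; apply: (@side_trans _ _ _ _ _ _ r).
  by rewrite side_sym //; exact: glue_orbit.
by move: rl; rewrite -/(side _ _ _ _ _ _) side_sym // side_phi.
Qed.

Lemma clockwise_minimal_of_minimal : clockwise_minimal alpha sigma r ing.
Proof.
split=> // x /orP[rx|rx]; have /andP[H1 H2] := contour_backward rx; right.
  by right; rewrite H1 H2 root_not_alpha.
by left; rewrite alphaK in H2; rewrite H1 H2 -[x in in_root x]alphaK root_not_alpha.
Qed.

(** Let [B] be the unreached darts: all at inner vertices, with every edge ingoing there coming from
    [B]. The weight [d] of each of these vertices is then carried by inner edges inside [B], which
    [density] forbids. *)
Lemma accessible_of_minimal : accessible alpha sigma r ing.
Proof.
exists r; first exact: connect0.
pose K y := connect (acc_rel alpha sigma ing) r y.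
have Ss : connect_sym (frel sigma) by exact: fconnect_sym.
have Kv x y : x ~v y -> K x -> K y.
  move=> xy rx; apply: (connect_ind (P := K) xy rx) => u v /eqP<- ru.
  by apply: connect_trans ru (connect1 _); rewrite /acc_rel eqxx.
have Ka x : ing x -> K (alpha x) -> K x.
  move=> ix ra; apply: connect_trans ra (connect1 _).
  by rewrite /acc_rel alphaK eqxx ix orbT.
(* The contour is directed against [ph], so reachability passes from [ph u] back to [u] along the
   [ph]-path from [x] to [r]. *)
have Kr x : in_root x -> K x.
  move=> rx; have xr : fconnect ph x r by rewrite fconnect_sym.
  suff [_] : in_root r /\ (K r -> K x) by apply; exact: connect0.
  apply: (connect_ind (P := fun z => in_root z /\ (K z -> K x)) xr); first by [].
  move=> u v /eqP<- [ru H]; split; first by apply: connect_trans ru (fconnect1 _ _).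
  move=> Kp; apply: H; apply: Ka; first by have /andP[] := contour_backward ru.
  by apply: Kv Kp; rewrite svS; exact: fconnect1.
have Ko x : outer_vertex x -> K x by case/existsP=> y /andP[/Kr Ky yx]; apply: Kv Ky.
move=> x; apply: contraT => nKx.
pose B := [set y | ~~ K y]; pose A := [set y in B | alpha y \in B].
have xB : x \in B by rewrite inE.
have cB : fclosed sigma B.
  apply: (intro_closed Ss) => y z yz; rewrite !inE; apply: contra; apply: Kv.
  by rewrite svS; apply: connect1.
have HA : edge_closed A by move=> y; rewrite !inE alphaK andbC.
have SB : \sum_(y in B) w y = d * fcard sigma B.
  apply: sum_vertices_const => // y yB; rewrite -(orientation_vertex Hor).
  case: Hor => _ /(_ y)[_ _ _]; apply.
  by move: yB; rewrite inE; apply: contra; apply: Ko.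
have SA : \sum_(y in B) w y = \sum_(y in A) w y.
  rewrite (big_setID A) (setIidPr _) /=; last by apply/subsetP=> y; rewrite inE => /andP[].
  rewrite [X in _ + X]big1 ?addn0 // => y; rewrite in_setD [y \in A]inE => /andP[yA yB].
  apply/eqP; rewrite eqn0Ngt -ingE; apply: contra yA => iy; rewrite yB /=.
  by move: yB; rewrite !inE; apply: contra; apply: Ka.
have EA : 2 * \sum_(y in A) w y = (d - 2) * #|A|.
  apply: sum_edges_const => // y; rewrite inE => /andP[yB _].
  case: Hor => _ /(_ y)[_ + _ _]; apply.
  by move: yB; rewrite inE; apply: contra => /(outer_edge_vertex Hmap); apply: Ko.
have VB : 0 < fcard sigma B by apply: n_comp_gt0 xB.
have [A0|[y yA]] := set_0Vmem A.
  by move: EA; rewrite -SA SB A0 cards0; nia.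
have := density Hmap girth (ltnW Hd) HA yA; rewrite -EA -SA SB ltnNge.
rewrite leq_mul // leq_mul // !fcardE; apply: subset_leq_card; apply: setIS.
apply/subsetP=> z /touchedP[t tA zt]; rewrite (closed_connect cB zt).
by move: tA; rewrite inE => /andP[].
Qed.

Lemma admissible_of_orientation : admissible alpha sigma r ing w.
Proof.
split; [exact: simple| |exact: outer_edge_ing] => x /outer_vertex_sum E.
have E1 : \sum_(y | (x ~v y) && ing y) w y = 1 by have := orientation_vertex Hor x; rewrite E.
rewrite /indegree; apply/eqP; rewrite eqn_leq; apply/andP; split.
  apply: leq_trans (_ : \sum_(y | (x ~v y) && ing y) w y <= 1); last by rewrite E1.
  by rewrite -sum1_card; apply: leq_sum => y; rewrite inE ingE => /andP[].
rewrite lt0n; apply/eqP=> /card0_eq H0; by move: E1; rewrite big_pred0.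
Qed.

Lemma minimal_in_Btilde : in_Btilde alpha sigma r ing w.
Proof.
split; [exact: clockwise_minimal_of_minimal|exact: accessible_of_minimal|].
exact: admissible_of_orientation.
Qed.

End MinimalProperties.

Theorem theorem13 (d : nat) (T : finType) (alpha sigma : {perm T}) (r : T) :
  3 <= d ->
  is_map alpha sigma ->
  is_dangulation alpha sigma d ->
  ((exists (ing : T -> bool) (w : T -> nat), dd2_orientation alpha sigma r ing w d)
     <-> girth_eq alpha sigma d) /\
  (girth_eq alpha sigma d ->
     (exists (ing : T -> bool) (w : T -> nat),
        dd2_orientation alpha sigma r ing w d /\ minimal alpha sigma r ing) /\
     (forall (ing : T -> bool) (w : T -> nat),
        dd2_orientation alpha sigma r ing w d -> minimal alpha sigma r ing ->
        in_Btilde alpha sigma r ing w)).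
Proof.
move=> Hd Hmap Hdang; split; last move=> Hg; split.
- by case=> ing [w Hor]; exact: girth_of_orientation Hor.
- by move=> Hg; exact: orientation_exists.
- have [ing [w Hor]] := orientation_exists r Hmap Hd Hdang Hg.
  exact: minimal_exists Hor.
- by move=> ing w; apply: minimal_in_Btilde.
Qed.
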